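(* Let $p$ be a prime, let $t,k$ be positive integers, $q=p^t$ and $\Delta=(q^k-1)/(q-1)$. Suppose that $3\mid (q^k-1)$ and $3\nmid\Delta$. Let $a_1,a_2$ be any integers such that $a_1-a_2=\pm\frac{q^k-1}{3}$, let $$n=\max\left\{\frac{q^k-1}{\gcd(q^k-1,a_1)},\ \frac{q^k-1}{\gcd(q^k-1,a_2)}\right\},$$ and let $a=a_1$ if $n=\frac{q^k-1}{\gcd(q^k-1,a_1)}$, and $a=a_2$ otherwise. Suppose also that $\gcd(\Delta,a)=2$, and let $\lambda$ be the positive integer such that $\gcd(q-1,\frac a2)=\frac{q-1}{\lambda}$. Let $\mathcal C_{(a_1)}$, $\mathcal C_{(a_2)}$ and $\mathcal C_{(a_1,a_2)}$ be the cyclic codes over $\mathbb F_q$ with parity-check polynomials $h_{a_1}(x)$, $h_{a_2}(x)$ and $h_{a_1}(x)h_{a_2}(x)$, respectively. Then: (A) $\mathcal C_{(a_1)}$ and $\mathcal C_{(a_2)}$ are two different semiprimitive two-weight irreducible cyclic codes of length $n$ and dimension $k$. Moreover, they have the same weight distribution, namely: weight $0$ with frequency $1$; weight $\frac{\lambda}{2}(q^{k-1}-q^{(k-2)/2})$ with frequency $\frac{q^k-1}{2}$; weight $\frac{\lambda}{2}(q^{k-1}+q^{(k-2)/2})$ with frequency $\frac{q^k-1}{2}$. (B) $\mathcal C_{(a_1,a_2)}$ is an $[n,2k]$ cyclic code over $\mathbb F_q$ (length $n$, dimension $2k$) with the following weight distribution: - weight $0$, frequency $1$; - weight $\frac{\lambda}{3}(q^{k-1}-q^{(k-2)/2})$,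 frequency $\frac{3(q^k-1)}{2}$; - weight $\frac{\lambda}{3}(q^{k-1}+q^{(k-2)/2})$, frequency $\frac{3(q^k-1)}{2}$; - weight $\frac{\lambda}{2}(q^{k-1}-q^{(k-2)/2})$, frequency $\frac{(q^k-1)(q^k-5)}{8}$; - weight $\frac{\lambda}{6}(3q^{k-1}-q^{(k-2)/2})$, frequency $\frac{3(q^k-1)^2}{8}$; - weight $\frac{\lambda}{6}(3q^{k-1}+q^{(k-2)/2})$, frequency $\frac{3(q^k-1)^2}{8}$; - weight $\frac{\lambda}{2}(q^{k-1}+q^{(k-2)/2})$, frequency $\frac{(q^k-1)(q^k-5)}{8}$.
   Context: Fix a primitive element $\gamma$ of $\mathbb F_{q^k}$ (a generator of $\mathbb F_{q^k}^*$). For any integer $a$, $h_a(x)\in\mathbb F_q[x]$ denotes the minimal polynomial of $\gamma^{-a}$ over $\mathbb F_q$. The cyclic code of length $n$ over $\mathbb F_q$ with parity-check polynomial $h(x)$ (where $h(x)\mid x^n-1$) is the ideal of $\mathbb F_q[x]/(x^n-1)$ generated by $(x^n-1)/h(x)$, regarded as a subspace of $\mathbb F_q^n$ via coefficient vectors; all three codes are taken with length $n$. The code is irreducible if $h$ is irreducible over $\mathbb F_q$. The weight distribution lists, for each Hamming weight, the number (frequency) of codewords having that weight. A code is two-weight if it has exactly two nonzero Hamming weights. Semiprimitive code: for an integer $a$ put $u=\gcd(\Delta,a)$. An irreducible cyclic code with parity-check polynomial $h_a(x)$ of degree $k$ is called semiprimitive if $u\ge 2$ and $-1$ is congruent to a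 power of $p$ modulo $u$. *)

(* Defs.v *)
From HB Require Import structures.
From mathcomp Require Import all_boot all_order all_fingroup all_algebra all_field.

Set Implicit Arguments.
Unset Strict Implicit.
Unset Printing Implicit Defensive.

Import GRing.Theory.

Local Open Scope ring_scope.

Section FieldExtension.

Variables (F : finFieldType) (L : fieldExtType F).

Definition primitive_element (gamma : L) : Prop :=
  gamma != 0 /\ forall y : L, y != 0 -> exists i : nat, y = gamma ^+ i.

Fact minpoly_base_subproof (x : L) :
  exists h : {poly F}, map_poly (in_alg L) h == minPoly 1%AS x.
Proof. by have /polyOver1P[h ->] := minPolyOver 1%AS x; exists h. Qed.

(* The library's [minPoly 1%AS x] has type [{poly L}]; this is the same
   polynomial with its coefficients read in [F]. *)
Definition minpoly_base (x : L) : {poly F} := xchoose (minpoly_base_subproof x).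

Lemma minpoly_baseE (x : L) :
  map_poly (in_alg L) (minpoly_base x) = minPoly 1%AS x.
Proof. exact/eqP/(xchooseP (minpoly_base_subproof x)). Qed.

Definition h_ (gamma : L) (a : int) : {poly F} := minpoly_base (gamma ^ (- a)).

Definition Delta : nat := (#|F| ^ \dim {:L} - 1) %/ (#|F| - 1).

End FieldExtension.

Section Codes.

Variables (F : finFieldType) (n : nat).

(* [{poly %/ 'X^n - 1}] is the expected quotient ring only when [0 < n]
   (for [n = 0] the library replaces the modulus by ['X]). *)
Definition check_ideal (h : {poly F}) : {set {poly %/ ('X^n - 1 : {poly F})}} :=
  [set r * in_qpoly ('X^n - 1) (('X^n - 1) %/ h)
     | r : {poly %/ ('X^n - 1 : {poly F})}].

(* The span adds no vector, see [mem_cyclic_code]: it only packages the set of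
   coefficient vectors of the ideal as a subspace. *)
Definition cyclic_code (h : {poly F}) : {vspace 'rV[F]_n} :=
  <<[seq poly_rV (val c) | c in check_ideal h]>>%VS.

Lemma mem_cyclic_code (h : {poly F}) (v : 'rV[F]_n) :
  reflect (exists2 c, c \in check_ideal h & v = poly_rV (val c))
          (v \in cyclic_code h).
Proof.
apply: (iffP idP) => [|[c Ic ->]]; last by apply/memv_span/image_f.
rewrite /cyclic_code; set s := image _ _ => /(coord_span (X := in_tuple s)) ->.
elim/big_ind: _ => [|x y [c Ic ->] [d Id ->]|i _].
- exists 0; last by rewrite raddf0.
  by apply/imsetP; exists 0; rewrite ?inE ?mul0r.
- exists (c + d); last by rewrite raddfD.
  have [/imsetP[r _ ->] /imsetP[r' _ ->]] := (Ic, Id).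
  by apply/imsetP; exists (r + r') => //; rewrite mulrDl.
have /imageP[c Ic ->] : (in_tuple s)`_i \in s by apply: mem_nth.
exists (coord (in_tuple s) i v *: c); last by rewrite -linearZ.
have /imsetP[r _ ->] := Ic.
by apply/imsetP; exists (coord (in_tuple s) i v *: r) => //; rewrite scalerAl.
Qed.

Definition has_parity_check (h : {poly F}) (C : {vspace 'rV[F]_n}) : Prop :=
  h %| 'X^n - 1 /\ C = cyclic_code h.

Definition irreducible_code (h : {poly F}) (C : {vspace 'rV[F]_n}) : Prop :=
  has_parity_check h C /\ irreducible_poly h.

Definition wt (c : 'rV[F]_n) : nat := #|[set i | c 0 i != 0]|.

Definition two_weight (C : {vspace 'rV[F]_n}) : Prop :=
  size (undup [seq wt c | c in [pred c | (c \in C) && (wt c != 0)%N]]) = 2%N.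

(* [tbl] lists pairs (weight, frequency).  Weights and frequencies are given as
   rationals so that the divisions in explicit tables are exact; an entry with
   nonzero frequency forces its weight to be a natural number. *)
Definition weight_distribution (C : {vspace 'rV[F]_n})
    (tbl : seq (rat * rat)) : Prop :=
  [/\ uniq (unzip1 tbl),
      forall c, c \in C -> (wt c)%:R \in unzip1 tbl
    & forall w f : rat, (w, f) \in tbl ->
        #|[set c : 'rV[F]_n | (c \in C) && ((wt c)%:R == w)]|%:R = f].

End Codes.

Definition semiprimitive (p : nat) (F : finFieldType) (L : fieldExtType F)
    (gamma : L) (n : nat) (a : int) (C : {vspace 'rV[F]_n}) : Prop :=
  let u := gcdn (Delta L) `|a| in
  [/\ irreducible_code (h_ gamma a) C,
      size (h_ gamma a) = (\dim {:L}).+1,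
      (2 <= u)%N
    & exists j : nat, (- 1 = (p ^ j)%N %[mod u])%Z].

(* Main.v *)
(* Put g = gamma^a and let w = gamma^(b-a), a primitive cube root of unity, which
   lies in F because 3 | q - 1.  For a nonzero functional phi : L -> F, the words
   (phi (g^i (y1 + w^i y2)))_i exhaust the code with check polynomial h_a h_b, and
   those with y2 = 0 (resp. y1 = 0) the code with check polynomial h_a (resp. h_b):
   they lie in the codes, and an injectivity-plus-dimension count does the rest.

   Splitting i modulo 3, the weight is a sum of three terms, depending on
   v_r = w^r (y1 + w^r y2).  Since <g^3> F^* is the group of squares of L^*, each
   term depends only on the quadratic class of v_r, through the number of squares z
   with phi (z v_r) != 0.  The first two moments of that number determine its two
   values, with no need for Gauss sums.  Finally v_0 + v_1 + v_2 = 0, and the number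
   of zero-sum triples with prescribed quadratic classes follows from the symmetries
   of the problem, -1 being a square because [L : F] is even. *)
Require Import Defs.
From HB Require Import structures.
From mathcomp Require Import all_boot all_order all_fingroup all_algebra all_field.
From mathcomp Require Import zify ring lra.
Import Order.TTheory GRing.Theory Num.Theory.
Local Open Scope ring_scope.

(** * Quadratic classes and zero-sum triples *)

(** [None] is the class of zero and [M] the common size of the two nonzero classes. With three
    nonzero classes the values are [M] times the cyclotomic numbers of order two of a field in which
    [-1] is a square. *)
Definition triples_value (M : nat) (x y z : option bool) : nat :=
  (match x, y, z with
  | None, None, None => 1
  | None, Some b, Some c | Some b, None, Some c | Some b, Some c, None =>
      if b == c then M else 0
  | Some a, Some b, Some c =>
      if (a == b) && (b == c) then M * (M - 2) %/ 2
      else M ^ 2 %/ 2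
  | _, _, _ => 0
  end)%N.

Section QuadraticClasses.

Variables (K : finFieldType) (chi : K -> bool) (g0 : K).
Hypothesis chiM : forall x y, x != 0 -> y != 0 -> chi (x * y) = chi x (+) chi y.
Hypothesis g0_neq0 : g0 != 0.
Hypothesis chi_g0 : chi g0 = true.
Hypothesis chiN1 : chi (- 1) = false.

(** [chi] is the quadratic character written additively: [false] on squares, [true] on
    nonsquares. *)
Definition qclass (x : K) : option bool := if x == 0 then None else Some (chi x).

Definition class_size : nat := #|[set x | qclass x == Some false]|.

Lemma qclass0 : qclass 0 = None.
Proof. by rewrite /qclass eqxx. Qed.

Lemma qclassM (x y : K) : x != 0 -> chi x = false -> qclass (x * y) = qclass y.
Proof.
move=> x0 cx; rewrite /qclass mulf_eq0 (negPf x0) /=.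
by case: eqVneq => // y0; rewrite chiM // cx.
Qed.

Lemma qclassN (x : K) : qclass (- x) = qclass x.
Proof. by rewrite -mulN1r qclassM // oppr_eq0 oner_eq0. Qed.

Lemma qclass_g0M (x : K) : qclass (g0 * x) = omap negb (qclass x).
Proof.
rewrite /qclass mulf_eq0 (negPf g0_neq0) /=.
by case: eqVneq => // x0; rewrite chiM // chi_g0.
Qed.

Lemma omap_negbK : involutive (omap negb).
Proof. by case=> // b /=; rewrite negbK. Qed.

(** Multiplication by [g0] exchanges the two nonzero classes. *)
Lemma card_qclass (c : option bool) :
  #|[set x | qclass x == c]| = if c is Some _ then class_size else 1%N.
Proof.
case: c => [[] |].
- rewrite /class_size -[RHS](card_imset _ (mulfI g0_neq0)); apply: eq_card => x.
  rewrite inE; apply/idP/imsetP => [/eqP cx | [y + ->]].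
    exists (x / g0); last by rewrite mulrC divfK.
    rewrite inE; apply/eqP/(inv_inj omap_negbK).
    by rewrite -qclass_g0M mulrC divfK.
  by rewrite inE qclass_g0M => /eqP->.
- by [].
- apply/eqP/cards1P; exists 0; apply/setP => x.
  by rewrite !inE /qclass; case: (x == 0).
Qed.

Lemma sum_option_bool (f : option bool -> nat) :
  (\sum_c f c = f None + f (Some false) + f (Some true))%N.
Proof.
rewrite (bigD1 None) //= (bigD1 (Some false)) //= (bigD1 (Some true)) //=.
by rewrite big1 ?addn0 ?addnA // => -[[]|].
Qed.

Lemma card_class_size : #|K| = class_size.*2.+1.
Proof.
have -> : #|K| = (\sum_c #|[set x | qclass x == c]|)%N.
  rewrite -sum1_card (partition_big qclass predT) //=.
  by apply: eq_bigr => c _; rewrite -sum1_card; apply: eq_bigl => x; rewrite !inE.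
by rewrite sum_option_bool !card_qclass -addnA addnn add1n.
Qed.

(* The classes of the three terms of the zero-sum triple
   [(v.1, v.2, - (v.1 + v.2))]; the sign is dropped since [-1] is a square. *)
Definition triples (x y z : option bool) : nat :=
  #|[set v : K * K |
      [&& qclass v.1 == x, qclass v.2 == y & qclass (v.1 + v.2) == z]]|.

Lemma triples_swap x y z : triples x y z = triples y x z.
Proof.
pose f (v : K * K) := (v.2, v.1).
have fK : involutive f by case.
rewrite /triples -[LHS](card_imset _ (inv_inj fK)); apply: eq_card => v.
rewrite (can2_imset_pre _ fK fK) !inE /=.
by rewrite addrC; do !case: (_ == _).
Qed.

(** In the zero-sum triple this exchanges the second and third terms; the sign is harmless because
    [-1] is a square. *)
Lemma triples_swap_last x y z : triples x y z = triples x z y.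
Proof.
pose f (v : K * K) := (v.1, - (v.1 + v.2)).
have fK : involutive f by case=> a b; rewrite /f /=; congr pair; ring.
rewrite /triples -[LHS](card_imset _ (inv_inj fK)); apply: eq_card => v.
rewrite (can2_imset_pre _ fK fK) !inE /= qclassN.
have -> : v.1 - (v.1 + v.2) = - v.2 by ring.
by rewrite qclassN; do !case: (_ == _).
Qed.

Lemma triples_flip x y z :
  triples (omap negb x) (omap negb y) (omap negb z) = triples x y z.
Proof.
pose f (v : K * K) := (g0 * v.1, g0 * v.2).
have f_inj : injective f.
  by case=> a b [c d] [] /(mulfI g0_neq0)-> /(mulfI g0_neq0)->.
rewrite /triples -[RHS](card_imset _ f_inj); apply: eq_card => -[a b]; rewrite inE /=.
apply/idP/imsetP => [/and3P[/eqP ca /eqP cb /eqP cab] | [[c d] + [-> ->]]].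
  exists (a / g0, b / g0); last by rewrite /f /= !(mulrC g0) !divfK.
  have divE u : qclass (u / g0) = omap negb (qclass u).
    by rewrite -{2}(divfK g0_neq0 u) [_ * g0]mulrC qclass_g0M omap_negbK.
  by rewrite inE /= -mulrDl !divE ca cb cab !omap_negbK !eqxx.
rewrite inE /= => /and3P[/eqP<- /eqP<- /eqP<-].
by rewrite -mulrDr !qclass_g0M !eqxx.
Qed.

Lemma sum_triples x y :
  (\sum_z triples x y z
    = #|[set v | qclass v == x]| * #|[set v | qclass v == y]|)%N.
Proof.
rewrite -cardsX -[RHS]sum1_card.
rewrite [RHS](partition_big (fun v => qclass (v.1 + v.2)) predT) //=.
apply: eq_bigr => c _; rewrite /triples -sum1_card; apply: eq_bigl => v.
by rewrite !inE andbA.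
Qed.

Lemma triples_None x y : triples x y None =
  if x == y then if x is Some _ then class_size else 1%N else 0%N.
Proof.
case: (eqVneq x y) => [<- | xy].
  rewrite -card_qclass -[RHS](card_imset _ (f := fun v => (v, - v))); last first.
    by move=> v w [].
  apply: eq_card => -[a b]; rewrite inE /=.
  apply/and3P/imsetP => [[ca cb] | [v + [-> ->]]].
    rewrite {1}/qclass; case: ifP => // /eqP ab _.
    exists a; rewrite ?inE //; congr pair; apply/eqP.
    by rewrite -addr_eq0 addrC ab.
  by rewrite inE qclassN subrr qclass0.
apply/eqP; rewrite cards_eq0; apply/eqP/setP => -[a b]; rewrite !inE /=.
apply/and3P=> -[/eqP ca /eqP cb]; rewrite {1}/qclass; case: ifP => // /eqP ab _.
case/eqP: xy; rewrite -ca -cb -[b]opprK qclassN; congr qclass.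
by apply/eqP; rewrite -addr_eq0 ab.
Qed.

(* The symmetries (permuting the terms, multiplying by a nonsquare) and the
   marginals [sum_triples] leave a single unknown in a linear system. *)
Lemma triplesE x y z : triples x y z = triples_value class_size x y z.
Proof.
have N1 b c : triples (Some b) (Some c) None = if b == c then class_size else 0%N.
  by rewrite triples_None; case: b c => [] [].
have N2 b c : triples (Some b) None (Some c) = if b == c then class_size else 0%N.
  by rewrite triples_swap_last N1.
have N3 b c : triples None (Some b) (Some c) = if b == c then class_size else 0%N.
  by rewrite triples_swap N2.
pose t b c d := triples (Some b) (Some c) (Some d).
have s1 b c d : t b c d = t c b d by apply: triples_swap.
have s2 b c d : t b c d = t b d c by apply: triples_swap_last.
have fl b c d : t (~~ b) (~~ c) (~~ d) = t b c d.
  exact: (triples_flip (Some b) (Some c) (Some d)).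
have S b c := sum_triples (Some b) (Some c).
have e1 := S false false; have e2 := S false true.
rewrite !sum_option_bool !N1 !card_qclass /= in e1 e2.
rewrite -/(t false false false) -/(t false false true) in e1.
rewrite -/(t false true false) -/(t false true true) in e2.
have E1 := s2 false false true; have E2 := fl false false true.
rewrite /= in E2.
have E3 := s2 true true false; have E4 := s1 true false true.
have E5 := s1 true false false.
have E6 := fl false false false; rewrite /= in E6.
(* By E1 to E5 all mixed triples have the same count [t], so [e2] reads [2 * t = M ^ 2]; [e1] then
   gives the unmixed count. *)
have V : t false false true = (class_size ^ 2 %/ 2)%N by rewrite -mulnn; lia.
have V' : t false false false = (class_size * (class_size - 2) %/ 2)%N.
  by rewrite mulnBr; rewrite -mulnn in V; lia.
case: x y z => [a|] [b|] [c|]; rewrite ?N1 ?N2 ?N3 ?triples_None //.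
  rewrite -/(t a b c) /=.
  by case: a b c => [] [] [] /=; rewrite -?V -?V'; lia.
by rewrite triples_swap_last triples_None.
Qed.

End QuadraticClasses.

(** * The two weights of the squares *)

(** Each fibre is a translate of [A]. The target is a bare finite type, so that both [F] and [F * F]
    fit. *)
Lemma card_fibers (U : finZmodType) (V : finType) (f : U -> V) (A : {set U}) :
  (forall u v, (f u == f v) = (u - v \in A)) -> (forall v, exists u, f u = v) ->
  #|U| = (#|V| * #|A|)%N.
Proof.
move=> fE f_onto.
have -> : #|U| = (\sum_v #|[set u | f u == v]|)%N.
  rewrite -sum1_card (partition_big f predT) //=.
  by apply: eq_bigr => v _; rewrite -sum1_card; apply: eq_bigl => u; rewrite !inE.
rewrite -sum_nat_const; apply: eq_bigr => v _.
have [u0 <-] := f_onto v.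
rewrite -[RHS](card_imset _ (addrI u0)); apply: eq_card => u.
rewrite inE fE; apply/idP/imsetP => [uA | [w wA ->]].
  by exists (u - u0) => //; rewrite addrC subrK.
by rewrite addrC addKr.
Qed.

Section SquareMoments.

Variables (F K : finFieldType) (iota : {rmorphism F -> K}).
Variables (phi : {additive K -> F}) (chi : K -> bool) (g0 : K).
Hypothesis phiZ : forall c x, phi (iota c * x) = c * phi x.
Hypothesis phi_neq0 : exists x, phi x != 0.
Hypothesis chiM : forall x y, x != 0 -> y != 0 -> chi (x * y) = chi x (+) chi y.
Hypothesis g0_neq0 : g0 != 0.
Hypothesis chi_g0 : chi g0 = true.
Hypothesis chi_iota : forall c, c != 0 -> chi (iota c) = false.

Local Notation cls := (qclass K chi).
Local Notation M := (class_size K chi).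

Lemma phi_onto (z : K) (b : F) : z != 0 -> exists u, phi (z * u) = b.
Proof.
have [x phix] := phi_neq0 => z0; exists (z^-1 * (iota (b / phi x) * x)).
by rewrite mulVKf // phiZ divfK.
Qed.

Lemma card_ker_phi (z : K) :
  z != 0 -> #|K| = (#|F| * #|[set u | phi (z * u)%R == 0%R]|)%N.
Proof.
move=> z0; apply: (card_fibers _ _ (fun u => phi (z * u))) => [x y | b].
  by rewrite inE mulrBr raddfB subr_eq0.
exact: phi_onto.
Qed.

(** Two nonproportional multipliers give independent functionals, so [u] is sent onto all of
    [F * F]. *)
Lemma card_ker_phi2 (z z' : K) : z != 0 -> (forall c, z' != iota c * z) ->
  #|K| = (#|F| ^ 2 * #|[set u | (phi (z * u) == 0) && (phi (z' * u) == 0)]%R|)%N.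
Proof.
move=> z0 indep.
have [u0 u01] := phi_onto z 1 z0.
have [w w1 w2] : exists2 w, phi (z * w) = 0 & phi (z' * w) = 1.
  (* The functional of [d] vanishes at [u0]. Hence a solution of [phi (d * w) = 1] can be corrected
     by a multiple of [u0] to kill [phi (z * w)], and then [phi (z' * w) = 1]. *)
  pose d := z' - iota (phi (z' * u0)) * z.
  have d0 : d != 0 by rewrite subr_eq0 indep.
  have [w dw] := phi_onto d 1 d0.
  exists (w - iota (phi (z * w)) * u0).
    by rewrite mulrBr raddfB /= mulrCA phiZ u01 mulr1 subrr.
  rewrite -dw mulrBr mulrBl !raddfB /= mulrCA -mulrA !phiZ.
  by rewrite [phi (z * w) * _]mulrC.
have -> : (#|F| ^ 2)%N = #|{: F * F}| by rewrite card_prod mulnn.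
pose f u := (phi (z * u), phi (z' * u)).
apply: (card_fibers _ _ f) => [x y | [a b]].
  by rewrite inE !mulrBr !raddfB !subr_eq0.
have fE c : f (iota a * u0 + iota c * w) = (a, a * phi (z' * u0) + c).
  rewrite /f !mulrDr !raddfD /= !(mulrCA z) !(mulrCA z') !phiZ.
  by rewrite u01 w1 w2 mulr0 !mulr1 addr0.
by exists (iota a * u0 + iota (b - a * phi (z' * u0)) * w); rewrite fE addrC subrK.
Qed.

Definition square_zeros (u : K) : nat :=
  #|[set z | (cls z == Some false) && (phi (z * u) == 0)]|.
Definition square_weight (u : K) : nat :=
  #|[set z | (cls z == Some false) && (phi (z * u) != 0)]|.

Arguments square_zeros u%_R.

Lemma square_zeros_weight u : (square_zeros u + square_weight u)%N = M.
Proof.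
rewrite /class_size -(cardsID [set z | phi (z * u) == 0]); congr (_ + _)%N.
  by apply: eq_card => z; rewrite !inE.
by apply: eq_card => z; rewrite !inE andbC.
Qed.

(** Multiplication by [s] permutes the squares. *)
Lemma square_zerosM (s u : K) : s != 0 -> chi s = false ->
  square_zeros (s * u) = square_zeros u.
Proof.
move=> s0 cs; rewrite /square_zeros -[LHS](card_imset _ (mulfI s0)).
apply: eq_card => z; rewrite inE; apply/imsetP/idP => [[w + ->] | cz].
  by rewrite inE qclassM // mulrA (mulrC w).
exists (s^-1 * z); last by rewrite mulVKf.
by rewrite inE mulrA (mulrC _ s) mulVKf // -(qclassM K chi chiM s) // mulVKf.
Qed.

Lemma square_zeros_qclass (u v : K) :
  cls u = cls v -> square_zeros u = square_zeros v.
Proof.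
rewrite /qclass; have [-> | u0] := eqVneq u 0; first by have [-> | //] := eqVneq v 0.
have [// | v0 [cuv]] := eqVneq v 0.
have uv0 : u / v != 0 by rewrite mulf_neq0 ?invr_eq0.
rewrite -[u](divfK v0) square_zerosM //.
apply: (@addIb (chi v)); rewrite -chiM // divfK // cuv.
Qed.

(** First moment: the kernel of [phi] consists of zero, squares, and nonsquares, the last being [g0]
    times squares. *)
Lemma square_zeros_sum1 :
  (square_zeros 1 + square_zeros g0).+1 = #|[set u | phi u == 0]|.
Proof.
have -> : #|[set u | phi u == 0]|
  = (\sum_c #|[set z | (cls z == c) && (phi z == 0)%R]|)%N.
  rewrite -sum1_card (partition_big cls predT) //=.
  apply: eq_bigr => c _; rewrite -sum1_card; apply: eq_bigl => x.
  by rewrite !inE andbC.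
rewrite sum_option_bool /square_zeros -addnA -add1n; congr (_ + (_ + _))%N.
- apply/esym/eqP/cards1P; exists 0; apply/setP => z.
  rewrite !inE /qclass; case: (eqVneq z 0) => [-> | //].
  by rewrite raddf0 !eqxx.
- by apply: eq_card => z; rewrite !inE mulr1.
- rewrite -[LHS](card_imset _ (mulfI g0_neq0)); apply: eq_card => z.
  rewrite inE; apply/imsetP/idP => [[w + ->] | ].
    by rewrite inE qclass_g0M // mulrC => /andP[/eqP-> ->].
  case/andP=> /eqP cz phiz; exists (g0^-1 * z); last by rewrite mulVKf.
  rewrite inE mulrAC mulVf // mul1r phiz andbT; apply/eqP/(inv_inj omap_negbK).
  by rewrite -(qclass_g0M K chi g0) // mulVKf.
Qed.

Lemma sum_qclass (f : option bool -> nat) :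
  (\sum_u f (cls u) = f None + M * (f (Some false) + f (Some true)))%N.
Proof.
rewrite (partition_big cls predT) //=.
under eq_bigr => c _.
  rewrite (eq_bigr (fun=> f c)); last by move=> u /eqP->.
  rewrite sum_nat_const.
  have -> : #|[pred u | cls u == c]| = #|[set u | cls u == c]|.
    by apply: eq_card => u; rewrite !inE.
  rewrite (card_qclass _ _ g0) //.
over.
rewrite sum_option_bool; lia.
Qed.

(** All of [F^*] is made of squares, so every nonzero [F]-multiple of [z] stays in its class. *)
Lemma card_square_multiples (z : K) : cls z = Some false ->
  #|[set w | (cls w == Some false) && [exists c, w == iota c * z]]| = #|F|.-1.
Proof.
move=> cz; have z0 : z != 0 by move: cz; rewrite /qclass; case: eqVneq.
have -> : #|F|.-1 = #|[set~ (0 : F)]| by rewrite cardsC1.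
rewrite -[RHS](card_imset _ (f := fun c => iota c * z)); last first.
  by move=> c d /(mulIf z0)/fmorph_inj.
apply: eq_card => w; rewrite inE; apply/idP/imsetP.
  case/andP => + /existsP[c /eqP wE]; rewrite wE => cw; exists c => //.
  rewrite !inE; apply: contraTneq cw => ->.
  by rewrite rmorph0 mul0r qclass0.
case=> c; rewrite !inE => c0 ->; rewrite qclassM ?fmorph_eq0 ?chi_iota //.
by rewrite cz eqxx; apply/existsP; exists c.
Qed.

(* Second moment: count the triples [(u, z, w)] with [z], [w] squares and
   [phi (z * u) = phi (w * u) = 0], according to whether [z] and [w] are
   proportional over [F].  The factor [M] is kept to avoid division. *)
Lemma square_zeros_sum2 (T : nat) : #|K| = (#|F| ^ 2 * T)%N ->
  (M * (M + (square_zeros 1) ^ 2 + (square_zeros g0) ^ 2)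
    = M * (M * T + #|F|.-1 * (#|F|.-1 * T)))%N.
Proof.
move=> cardK.
have qF : (0 < #|F|)%N by apply/card_gt0P; exists 0.
pose h (c : option bool) : nat :=
  square_zeros (if c is Some b then if b then g0 else 1 else 0).
have hE u : square_zeros u = h (cls u).
  apply: square_zeros_qclass.
  have c1 : chi 1 = false by rewrite -(rmorph1 iota) chi_iota ?oner_eq0.
  rewrite {1 3}/qclass; case: eqVneq => [_ | _]; first by rewrite qclass0.
  case cu: (chi u); rewrite /qclass; first by rewrite (negPf g0_neq0) chi_g0.
  by rewrite oner_eq0 c1.
have z0 : square_zeros 0 = M.
  by apply: eq_card => z; rewrite !inE mulr0 raddf0 eqxx andbT.
(* Zero contributes [M ^ 2] to the sum of squares, and each of the two nonzero classes contributes
   [M] equal terms. *)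
have -> : (M * (M + square_zeros 1 ^ 2 + square_zeros g0 ^ 2)
           = \sum_u square_zeros u ^ 2)%N.
  under eq_bigr => u _ do rewrite hE.
  rewrite (sum_qclass (fun c => (h c ^ 2)%N)) /h /= z0; lia.
pose S := [set z | cls z == Some false].
pose k2 z w := #|[set u | (phi (z * u) == 0) && (phi (w * u) == 0)]|.
have -> : (\sum_u square_zeros u ^ 2 = \sum_(z in S) \sum_(w in S) k2 z w)%N.
  transitivity (\sum_u \sum_(z in S) \sum_(w in S)
      ((phi (z * u) == 0)%R && (phi (w * u) == 0)%R : nat))%N.
    apply: eq_bigr => u _; rewrite -mulnn /square_zeros.
    have -> : #|[set z | (cls z == Some false) && (phi (z * u) == 0)]|
       = (\sum_(z in S) (phi (z * u) == 0)%R)%N.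
      rewrite -sum1_card big_mkcond [RHS]big_mkcond /=; apply: eq_bigr => z _.
      by rewrite !inE; case: (_ == Some false) => //=; case: (_ == 0).
    rewrite big_distrl; apply: eq_bigr => z _; rewrite big_distrr.
    by apply: eq_bigr => w _ /=; rewrite mulnb.
  rewrite exchange_big; apply: eq_bigr => z _; rewrite exchange_big.
  apply: eq_bigr => w _; rewrite /k2 -sum1_card [RHS]big_mkcond.
  by apply: eq_bigr => u _; rewrite inE; case: (_ && _).
rewrite -{1}/(#|S|) -sum_nat_const; apply: eq_bigr => z; rewrite inE => /eqP cz.
have zn0 : z != 0 by move: cz; rewrite /qclass; case: eqVneq.
pose D := [set w | (cls w == Some false) && [exists c, w == iota c * z]].
(* Every pair has at least [T] common zeros; a proportional pair has [#|F| * T], hence an excess of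
   [#|F|.-1 * T]. *)
have -> : (#|F|.-1 * (#|F|.-1 * T) = \sum_(w in S) if w \in D then #|F|.-1 * T else 0)%N.
  rewrite -big_mkcondr -(card_square_multiples z cz) -/D -sum_nat_const.
  by apply: eq_bigl => w; rewrite !inE; case: eqP.
rewrite -[M]/(#|S|) -sum_nat_const -big_split; apply: eq_bigr => w.
rewrite inE => cw /=; rewrite inE cw /=.
case: existsP => [[c /eqP wE] | indep].
  have c0 : c != 0.
    by apply: contraTneq cw => c0; rewrite wE c0 rmorph0 mul0r qclass0.
  have -> : k2 z w = #|[set u | phi (z * u) == 0]|.
    apply: eq_card => u; rewrite !inE wE -mulrA phiZ mulf_eq0 (negPf c0).
    by rewrite andbb.
  have /eqP := card_ker_phi z zn0; rewrite cardK -mulnn -mulnA eqn_pmul2l //.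
  by move=> /eqP<-; rewrite -mulSn prednK.
have := card_ker_phi2 z w zn0; rewrite cardK -/(k2 z w) => /(_ _)/eqP.
rewrite eqn_pmul2l ?expn_gt0 ?qF // => /(_ _)/eqP-> //; rewrite ?addn0 //.
by move=> c; apply/eqP => wE; case: indep; exists c; apply/eqP.
Qed.

(** The two moments give the sum and the sum of squares of the zero counts at [1] and [g0], hence
    the square of their difference, [((q - 1) * q ^ j) ^ 2]. The sign remains unknown and is
    recorded by [e]. *)
Lemma square_weight_values (j : nat) : #|K| = (#|F| ^ j.+1.*2)%N ->
  exists e : bool, forall u, u != 0 ->
    2 * (square_weight u)%:R = (#|F|%:R - 1)
      * (#|F|%:R ^+ j.*2.+1 + (- 1) ^+ (chi u (+) e) * #|F|%:R ^+ j) :> rat.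
Proof.
move=> cardK.
have c1 : chi 1 = false by rewrite -(rmorph1 iota) chi_iota ?oner_eq0.
have qF : (0 < #|F|)%N by apply/card_gt0P; exists 0.
pose T := (#|F| ^ j.*2)%N.
have cardK2 : #|K| = (#|F| ^ 2 * T)%N by rewrite cardK doubleS -expnD add2n.
have M_gt0 : (0 < M)%N.
  by apply/card_gt0P; exists 1; rewrite inE /qclass oner_eq0 c1.
have := square_zeros_sum2 T cardK2 => /eqP; rewrite eqn_pmul2l // => /eqP.
have := square_zeros_sum1.
have := card_ker_phi 1 (oner_neq0 _).
under eq_finset => u do rewrite mul1r.
move=> + sum0; rewrite -sum0 cardK2 => /eqP.
rewrite -mulnn -mulnA eqn_pmul2l // => /eqP sum1 sum2.
have MK := card_class_size K chi g0 chiM g0_neq0 chi_g0.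
rewrite cardK2 -[M.*2.+1]addn1 -addnn in MK; rewrite -addn1 in sum1.
have TE : T%:R = (#|F|%:R ^+ j) ^+ 2 :> rat by rewrite /T natrX -muln2 exprM.
clearbody T.
have W1 := square_zeros_weight 1; have Wg := square_zeros_weight g0.
move: sum1 sum2 MK W1 Wg.
set q := #|F| in qF TE *; set z1 := square_zeros 1; set zg := square_zeros g0.
set w1 := square_weight 1; set wg := square_weight g0.
move=> /(congr1 (GRing.natmul (1 : rat))) sum1 /(congr1 (GRing.natmul (1 : rat))) sum2.
move=> /(congr1 (GRing.natmul (1 : rat))) MK /(congr1 (GRing.natmul (1 : rat))) W1.
move=> /(congr1 (GRing.natmul (1 : rat))) Wg.
have q1 : q.-1%:R = q%:R - 1 :> rat by rewrite -subn1 natrB.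
rewrite !(natrD, natrM, natrX, q1) in sum1 sum2 MK W1 Wg.
have -> : q%:R ^+ j.*2.+1 = q%:R * T%:R :> rat by rewrite exprS TE -muln2 exprM.
rewrite TE in sum1 sum2 MK *.
set s := q%:R ^+ j in TE sum1 sum2 MK *.
have zgE : zg%:R = q%:R * s ^+ 2 - 1 - z1%:R :> rat by lra.
have ME : M%:R = (q%:R ^+ 2 * s ^+ 2 - 1) / 2 :> rat by lra.
have /eqP : (z1%:R - zg%:R) ^+ 2 = ((q%:R - 1) * s) ^+ 2 :> rat.
  by rewrite ME zgE in sum2; rewrite zgE; nra.
rewrite eqf_sqr.
have wE u : u != 0 -> square_weight u = if chi u then wg else w1.
  move=> u0; have := square_zeros_weight u.
  have -> : square_zeros u = if chi u then zg else z1.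
    case cu: (chi u); apply: square_zeros_qclass; rewrite /qclass.
      by rewrite (negPf u0) (negPf g0_neq0) cu chi_g0.
    by rewrite (negPf u0) oner_eq0 cu c1.
  have := square_zeros_weight 1; have := square_zeros_weight g0.
  rewrite -/z1 -/zg -/w1 -/wg; case: (chi u); lia.
case/orP => /eqP dz; [exists true | exists false] => u u0; rewrite wE //;
  case: (chi u) => /=; rewrite ?expr1 ?expr0; nra.
Qed.

End SquareMoments.

(** * Weights of the codewords *)

Lemma sum_mod3 (f : nat -> nat) (m : nat) :
  (\sum_(i < 3 * m) f i = \sum_(r < 3) \sum_(j < m) f (3 * j + r))%N.
Proof.
rewrite !big_ord_recr big_ord0 /= add0n.
elim: m => [|m IH]; first by rewrite muln0 !big_ord0.
rewrite mulnS addnC addn3 !big_ord_recr IH /=.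
rewrite addn0 addn1 addn2; lia.
Qed.

(** * Encoding of weights by pairs of small integers *)

Section WeightTypes.

Variables (e : bool) (Q s l : rat).
Hypotheses (s_gt0 : 0 < s) (l_gt0 : 0 < l) (Q_large : 6 * s < Q).

(** For an integer [x] the conclusion means [x = 0]. The bound 6 is the largest difference of two
    coordinates in [type_box]. *)
Lemma small_ratio (x y : rat) : x * Q = y * s -> - 6 <= y -> y <= 6 -> -1 < x < 1.
Proof.
move=> xy /(ler_wpM2r (ltW s_gt0)) y1 /(ler_wpM2r (ltW s_gt0)) y2.
have Qp : 0 < Q by apply: lt_trans Q_large; rewrite mulr_gt0.
by rewrite -(ltr_pM2r Qp) -[x < 1](ltr_pM2r Qp) xy; apply/andP; split;
  [apply: lt_le_trans y1 | apply: le_lt_trans y2 _]; rewrite ?mul1r ?mulN1r ?mulNr ?ltrN2.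
Qed.

(* A type [(i, j)] encodes the weight [l / 6 * (i * Q + j * s)]; the bit [e]
   records which of the two classes has the smaller weight. *)
Definition class_type (c : option bool) : int * int :=
  if c is Some b then (1, if b (+) e then -1 else 1) else (0, 0).

Definition type_weight (t : int * int) : rat := l / 6 * (t.1%:~R * Q + t.2%:~R * s).

Lemma type_weightD t t' : type_weight (t + t') = type_weight t + type_weight t'.
Proof. by rewrite /type_weight /= !rmorphD /=; ring. Qed.

Definition type_box (t : int * int) : bool := (`|t.1| <= 3) && (`|t.2| <= 3).

(** As [6 * s < Q], the [s] parts cannot compensate a difference in the [Q] parts, so a weight
    determines its type. *)
Lemma type_weight_eq (t t' : int * int) : type_box t -> type_box t' ->
  (type_weight t == type_weight t') = (t == t').
Proof.
case: t t' => [a b] [c d] /andP[/= a3 b3] /andP[/= c3 d3].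
apply/eqP/eqP => [|-> //]; rewrite /type_weight /=.
have l6 : l / 6 != 0 by rewrite mulf_neq0 ?gt_eqF // invr_gt0.
move=> /(mulfI l6) E.
have {}E : (a - c)%:~R * Q = (d - b)%:~R * s by rewrite !rmorphB /=; nra.
have db : (d - b)%:~R <= 6 :> rat by rewrite -[6]/(6%:~R) ler_int; lia.
have bd : - 6 <= (d - b)%:~R :> rat by rewrite -[- 6]/((- 6)%:~R) ler_int; lia.
have /andP[] := small_ratio _ _ E bd db.
rewrite -[1]/(1%:~R) -[- 1]/((- 1)%:~R) !ltr_int => ac ca.
have {ca}ac : a = c by lia.
move: E; rewrite ac subrr mul0r => /esym/eqP.
rewrite mulf_eq0 (gt_eqF s_gt0) orbF intr_eq0 subr_eq0 => /eqP->.
by [].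
Qed.

End WeightTypes.

(** Types of zero-sum triples: all terms zero, exactly one zero term (the other two are opposite,
    hence of one class), or no zero term. *)
Definition pair_types : seq (int * int) :=
  [:: (0, 0); (2, -2); (2, 2); (3, -3); (3, -1); (3, 1); (3, 3)].

(** The factors 3 count the position of the zero term, or of the term whose class differs from the
    other two. *)
Definition pair_freq (M : nat) (t : int * int) : nat :=
  if t == (0, 0) then 1 else if t.1 == 2 then (3 * M)%N else
  if (t == (3, 3)) || (t == (3, -3)) then (M * (M - 2) %/ 2)%N
  else (3 * (M ^ 2 %/ 2))%N.

Lemma triples_value_type e M x y z : triples_value M x y z != 0%N ->
  class_type e x + class_type e y + class_type e z \in pair_types.
Proof. by case: e x y z => [] [[]|] [[]|] [[]|]. Qed.

Lemma pair_types_box : {in pair_types, forall t, type_box t}.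
Proof. by apply/allP. Qed.

(** The bit [e] disappears from the result because the counts are symmetric in the two nonzero
    classes. *)
Lemma sum_triples_value e M t : t \in pair_types ->
  (\sum_x \sum_y \sum_z
     (if (class_type e x + class_type e y + class_type e z == t)%R
      then triples_value M x y z else 0))%N = pair_freq M t.
Proof.
move=> tP; rewrite !sum_option_bool; apply/eqP.
move: t tP; apply/allP; rewrite /= andbT.
by case: e => /=; rewrite /pair_freq /= !(add0n, addn0) !mulSn !mul0n !addn0 !addnA !eqxx.
Qed.

(** * Codewords attached to pairs of field elements *)

Section Codewords.

Variables (F K : finFieldType) (iota : {rmorphism F -> K}).
Variables (phi : {additive K -> F}) (chi : K -> bool) (g0 : K).
Hypothesis phiZ : forall c x, phi (iota c * x) = c * phi x.
Hypothesis phi_neq0 : exists x, phi x != 0.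
Hypothesis chiM : forall x y, x != 0 -> y != 0 -> chi (x * y) = chi x (+) chi y.
Hypothesis g0_neq0 : g0 != 0.
Hypothesis chi_g0 : chi g0 = true.
Hypothesis chi_iota : forall c, c != 0 -> chi (iota c) = false.

Variables (g : K) (w0 : F) (m j lam delta n : nat).
Hypothesis g_neq0 : g != 0.
Hypothesis chi_g : chi g = false.
Hypothesis gX : g ^+ (3 * m) = 1.
Hypothesis w0X3 : w0 ^+ 3 = 1.
Hypothesis w0_neq1 : w0 != 1.
Hypothesis square_gen : forall x, x != 0 -> chi x = false ->
  exists i c, c != 0 /\ x = iota c * g ^+ (3 * i).
Hypothesis cardK : #|K| = (#|F| ^ j.+1.*2)%N.
Hypothesis cardF : (6 < #|F|)%N.
Hypothesis lam_gt0 : (0 < lam)%N.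
Hypothesis m6 : (6 * m = lam * delta)%N.
Hypothesis deltaE : (delta * #|F|.-1 = #|K|.-1)%N.
Hypothesis nE : n = (3 * m)%N.

Local Notation cls := (qclass K chi).
Local Notation M := (class_size K chi).
Local Notation w := (iota w0).

(** Contribution to a weight of the positions in one residue class modulo 3. *)
Definition orbit_weight (u : K) : nat :=
  (\sum_(i < m) (phi (g ^+ (3 * i) * u) != 0)%R)%N.

Arguments orbit_weight u%_R.

(** A cyclic shift of the summation index, closed up by [g ^+ (3 * m) = 1]. *)
Lemma orbit_weightM_gen (u : K) : orbit_weight (g ^+ 3 * u) = orbit_weight u.
Proof.
rewrite /orbit_weight; case: m gX => [|m'] gm; first by rewrite !big_ord0.
rewrite big_ord_recr [RHS]big_ord_recl /= addnC; congr (_ + _)%N.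
  by rewrite mulrA -exprD -mulnSr gm muln0 expr0.
by apply: eq_bigr => i _; rewrite mulrA -exprD -mulnSr.
Qed.

Lemma orbit_weightM_iota (c : F) (u : K) :
  c != 0 -> orbit_weight (iota c * u) = orbit_weight u.
Proof.
by move=> c0; apply: eq_bigr => i _; rewrite mulrCA phiZ mulf_eq0 negb_or c0.
Qed.

Lemma orbit_weightM_square (x u : K) :
  x != 0 -> chi x = false -> orbit_weight (x * u) = orbit_weight u.
Proof.
move=> x0 /(square_gen _ x0)[i [c [c0 ->]]]; rewrite -mulrA orbit_weightM_iota //.
rewrite exprM; elim: i => [|i IH]; first by rewrite mul1r.
by rewrite exprS -mulrA orbit_weightM_gen.
Qed.

Local Notation sqw := (square_weight F K phi chi).

Lemma square_weightM_square (x u : K) :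
  x != 0 -> chi x = false -> sqw (x * u) = sqw u.
Proof.
move=> x0 cx; apply: (@addnI (square_zeros F K phi chi u)).
by rewrite square_zeros_weight -(square_zerosM F K phi chi chiM x) // square_zeros_weight.
Qed.

(* [orbit_weight] is invariant under squares, so it may be averaged over them. *)
Lemma orbit_weight_average (u : K) : (M * orbit_weight u = m * sqw u)%N.
Proof.
have chiX i : chi (g ^+ i) = false.
  elim: i => [|i IH]; first by rewrite expr0 -(rmorph1 iota) chi_iota ?oner_eq0.
  by rewrite exprS chiM ?expf_neq0 // chi_g IH.
transitivity (\sum_(z in [set z | cls z == Some false]) orbit_weight (z * u))%N.
  rewrite /class_size -sum_nat_const; apply: eq_bigr => z.
  rewrite inE /qclass; case: (eqVneq z 0) => // z0 /eqP[cz].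
  by rewrite orbit_weightM_square.
rewrite exchange_big /= -[m in RHS]card_ord -sum_nat_const; apply: eq_bigr => i _.
rewrite -(square_weightM_square (g ^+ (3 * i))) ?expf_neq0 //.
rewrite /square_weight -sum1_card big_mkcond [RHS]big_mkcond /=.
apply: eq_bigr => z _; rewrite !inE mulrCA.
by case: (_ == Some false) => //=; case: (_ == 0).
Qed.

Local Notation Q := (#|F|%:R ^+ j.*2.+1 : rat).
Local Notation s := (#|F|%:R ^+ j : rat).

(** Divide the averaging identity by [M]: since [M = delta * (q - 1) / 2] and [m = lam * delta / 6],
    only the factor [lam / 6] survives. *)
Lemma orbit_weight_values : exists e : bool, forall u,
  (orbit_weight u)%:R = type_weight Q s lam%:R (class_type e (cls u)).
Proof.
have [e We] := square_weight_values F K iota phi chi g0 phiZ phi_neq0 chiM g0_neq0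
  chi_g0 chi_iota j cardK.
exists e => u; rewrite /qclass /type_weight; case: eqVneq => [-> | u0] /=.
  rewrite /orbit_weight big1 ?mul0r ?addr0 ?mulr0 // => i _.
  by rewrite mulr0 raddf0 eqxx.
have MK := card_class_size K chi g0 chiM g0_neq0 chi_g0.
have c1 : chi 1 = false by rewrite -(rmorph1 iota) chi_iota ?oner_eq0.
have M_neq0 : M%:R != 0 :> rat.
  rewrite pnatr_eq0 -lt0n; apply/card_gt0P; exists 1.
  by rewrite inE /qclass oner_eq0 c1.
apply: (mulfI M_neq0); rewrite -natrM orbit_weight_average natrM.
have := We u u0; set W := (square_weight _ _ _ _ _)%:R => WE.
have -> : (if chi u (+) e then -1 else 1)%:~R = (- 1) ^+ (chi u (+) e) :> rat.
  by case: (_ (+) _); rewrite ?expr1 ?expr0 ?rmorphN ?rmorph1.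
have /(congr1 (GRing.natmul (1 : rat))) := deltaE.
rewrite MK natrM /= -muln2 natrM -subn1 natrB ?(ltnW (ltn_trans _ cardF)) // => dE.
have /(congr1 (GRing.natmul (1 : rat))) := m6; rewrite !natrM => mE.
move: ((-1) ^+ (chi u (+) e) : rat) WE => sg WE.
move: WE dE; set q : rat := #|F|%:R => WE dE.
move: (q ^+ j.*2.+1) (q ^+ j) WE => Q s WE.
have -> : m%:R = lam%:R * delta%:R / 6 :> rat by rewrite -mE mulrC mulKf.
have -> : M%:R = delta%:R * (q - 1) / 2 :> rat by rewrite dE mulfK.
have -> : W = (q - 1) * (Q + sg * s) / 2 by rewrite -WE mulrC mulKf.
by rewrite mul1r; ring.
Qed.

Definition codeword (y : K * K) : 'rV[F]_n :=
  \row_(i < n) phi (g ^+ i * (y.1 + w ^+ i * y.2)).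

Lemma omegaX3 : w ^+ 3 = 1. Proof. by rewrite -rmorphXn w0X3 rmorph1. Qed.

Lemma w0_neq0 : w0 != 0.
Proof. by apply: contra_eq_neq w0X3 => ->; rewrite expr0n eq_sym oner_eq0. Qed.

Lemma chi_omegaX i : chi (w ^+ i) = false.
Proof. by rewrite -rmorphXn chi_iota ?expf_neq0 ?w0_neq0. Qed.

Lemma omegaX_neq0 i : w ^+ i != 0.
Proof. by rewrite expf_neq0 // fmorph_eq0 w0_neq0. Qed.

Lemma omega_root : 1 + w + w ^+ 2 = 0.
Proof.
have w1 : w - 1 != 0 by rewrite subr_eq0 fmorph_eq1.
apply: (mulfI w1); have -> : (w - 1) * (1 + w + w ^+ 2) = w ^+ 3 - 1 by ring.
by rewrite omegaX3 subrr mulr0.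
Qed.

(** Write the position as [3 * i + r]: the power of [w] depends only on [r], and [g ^+ r] is a
    square, which [orbit_weight] ignores. *)
Lemma wt_codeword (y : K * K) : wt (codeword y)
  = (\sum_(r < 3) orbit_weight (y.1 + w ^+ r * y.2)%R)%N.
Proof.
pose f i := ((phi (g ^+ i * (y.1 + w ^+ i * y.2)) != 0) : nat).
transitivity (\sum_(i < 3 * m) f i)%N.
  rewrite -nE /wt -sum1_card big_mkcond; apply: eq_bigr => i _.
  by rewrite inE mxE /f; case: (_ == 0).
rewrite sum_mod3; apply: eq_bigr => r _.
have chiX i : chi (g ^+ i) = false.
  elim: i => [|i IH]; first by rewrite expr0 -(rmorph1 iota) chi_iota ?oner_eq0.
  by rewrite exprS chiM ?expf_neq0 // chi_g IH.
rewrite -(orbit_weightM_square (g ^+ r)) ?expf_neq0 //; apply: eq_bigr => i _.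
have wE : w ^+ (3 * i + r) = w ^+ r by rewrite exprD exprM omegaX3 expr1n mul1r.
by rewrite /f wE exprD mulrA.
Qed.

(* The classes of [v_r = w ^ r * (y.1 + w ^ r * y.2)]; the third one is that of
   [- v_2 = v_0 + v_1]. *)
Definition class_triple (y : K * K) : option bool * option bool * option bool :=
  (cls (y.1 + y.2), cls (w * (y.1 + w * y.2)),
   cls (y.1 + y.2 + w * (y.1 + w * y.2))).

Definition weight_type e (y : K * K) : int * int :=
  let: (a, b, c) := class_triple y in
  class_type e a + class_type e b + class_type e c.

Lemma codeword_weights : exists e : bool, forall y,
  (wt (codeword y))%:R = type_weight Q s lam%:R (weight_type e y).
Proof.
have [e owE] := orbit_weight_values; exists e => y.
rewrite wt_codeword !big_ord_recr big_ord0 /= add0n !natrD !owE -!type_weightD.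
congr (type_weight _ _ _ (class_type _ _ + class_type _ _ + class_type _ _)).
- by rewrite expr0 mul1r.
- by rewrite expr1 -[w in RHS]expr1 qclassM // ?omegaX_neq0 ?chi_omegaX.
(* This is [v_0 + v_1 = - v_2], from [1 + w + w ^+ 2 = 0] and [w ^+ 3 = 1]. *)
- have -> : y.1 + y.2 + w * (y.1 + w * y.2) = (- 1) * (w ^+ 2 * (y.1 + w ^+ 2 * y.2)).
    apply/eqP; rewrite -subr_eq0; apply/eqP.
    transitivity ((1 + w + w ^+ 2) * y.1 + (1 + w ^+ 3 * w + w ^+ 2) * y.2); first by ring.
    by rewrite omegaX3 mul1r omega_root !mul0r addr0.
  rewrite -(rmorphN1 iota) qclassM ?fmorph_eq0 ?oppr_eq0 ?oner_eq0 ?chi_iota //;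
    rewrite ?oppr_eq0 ?oner_eq0 //.
  by rewrite qclassM // ?omegaX_neq0 ?chi_omegaX.
Qed.

(** Because [w] differs from 1, [(v_0, v_1)] are linear coordinates on [K * K]. *)
Lemma card_class_triple a b c :
  #|[set y | class_triple y == (a, b, c)]| = triples K chi a b c.
Proof.
pose f (y : K * K) := (y.1 + y.2, w * (y.1 + w * y.2)).
have f_inj : injective f.
  have w_neq0 : w != 0 by rewrite fmorph_eq0 w0_neq0.
  case=> y1 y2 [z1 z2] [e1 /(mulfI w_neq0) e2].
  have /eqP : (w - 1) * (y2 - z2) = 0.
    have -> : (w - 1) * (y2 - z2) = (y1 + w * y2) - (z1 + w * z2) - ((y1 + y2) - (z1 + z2)).
      by ring.
    by rewrite e1 e2 !subrr.
  rewrite mulf_eq0 subr_eq0 fmorph_eq1 (negPf w0_neq1) subr_eq0 => /eqP yz.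
  by rewrite yz in e1 *; rewrite (addIr _ e1).
rewrite /triples -[RHS](card_preimset _ f_inj); apply: eq_card => y; rewrite !inE /class_triple /=.
by rewrite !xpair_eqE andbA.
Qed.

Lemma card_weight_type e t : t \in pair_types ->
  #|[set y | weight_type e y == t]| = pair_freq M t.
Proof.
move=> tP; rewrite -(sum_triples_value e _ _ tP).
rewrite -sum1_card (partition_big (fun y => (class_triple y).1.1) predT) //=.
apply: eq_bigr => a _.
rewrite (partition_big (fun y => (class_triple y).1.2) predT) //=.
apply: eq_bigr => b _.
rewrite (partition_big (fun y => (class_triple y).2) predT) //=.
apply: eq_bigr => c _.
have chiN1 : chi (- 1) = false by rewrite -(rmorphN1 iota) chi_iota // oppr_eq0 oner_eq0.
rewrite -(triplesE K chi g0 chiM g0_neq0 chi_g0 chiN1) -card_class_triple -sum1_card.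
case: ifP => abc.
  apply: eq_bigl => y; rewrite !inE /weight_type /class_triple.
  apply/idP/eqP => [/andP[/andP[/andP[_ /eqP->] /eqP->] /eqP->] // | [ea eb ec]].
  by rewrite ea eb ec abc !eqxx.
rewrite big_pred0 // => y; rewrite !inE /weight_type /class_triple.
apply/negP => /andP[/andP[/andP[+ /eqP ea] /eqP eb] /eqP ec].
by rewrite ea eb ec abc.
Qed.

(** A class triple that occurs has a nonzero count, and nonzero counts only produce the listed
    types. *)
Lemma weight_type_pair e y : weight_type e y \in pair_types.
Proof.
have chiN1 : chi (- 1) = false by rewrite -(rmorphN1 iota) chi_iota // oppr_eq0 oner_eq0.
rewrite /weight_type; case E : (class_triple y) => [[a b] c].
apply: (triples_value_type e M).
rewrite -(triplesE K chi g0 chiM g0_neq0 chi_g0 chiN1) -card_class_triple -lt0n.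
by apply/card_gt0P; exists y; rewrite inE E.
Qed.

Lemma s_gt0 : 0 < s.
Proof. by rewrite exprn_gt0 // ltr0n (ltn_trans _ cardF). Qed.

Lemma Q_large : 6 * s < Q.
Proof.
rewrite -addnn exprS exprD mulrA ltr_pM2r ?s_gt0 //.
apply: (@lt_le_trans _ _ #|F|%:R); first by rewrite ltr_nat.
by rewrite ler_peMr ?ler0n // -natrX ler1n expn_gt0 (ltn_trans _ cardF).
Qed.

Lemma codeword0 : codeword (0, 0) = 0.
Proof. by apply/rowP => i; rewrite !mxE /= mulr0 addr0 mulr0 raddf0. Qed.

Lemma codewordB y z : codeword (y - z) = codeword y - codeword z.
Proof.
by apply/rowP => i; rewrite !mxE -raddfB /=; congr (phi _); ring.
Qed.

(** The weight count itself gives a trivial kernel: weight zero forces type [(0, 0)], which has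
    frequency 1. *)
Lemma codeword_inj : injective codeword.
Proof.
have lam0 : 0 < lam%:R :> rat by rewrite ltr0n.
have [e wtE] := codeword_weights.
have c1 : weight_type e (0, 0) = (0, 0).
  by rewrite /weight_type /class_triple /= !(addr0, mulr0) qclass0.
have ker y : codeword y = 0 -> y = (0, 0).
  move=> cy.
  have ty : weight_type e y = (0, 0).
    apply/eqP; rewrite -(type_weight_eq _ _ _ s_gt0 lam0 Q_large) //; last first.
      exact/pair_types_box/weight_type_pair.
    by rewrite -{1}wtE cy -codeword0 wtE c1.
  have /eqP/cards1P[z zE] : #|[set y | weight_type e y == (0, 0)]| = 1%N.
    by rewrite card_weight_type.
  have : y \in [set y | weight_type e y == (0, 0)] by rewrite inE ty.
  have : (0, 0) \in [set y | weight_type e y == (0, 0)] by rewrite inE c1.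
  by rewrite zE !inE => /eqP-> /eqP.
move=> y z yz; apply/eqP; rewrite -subr_eq0; apply/eqP/ker.
by rewrite codewordB yz subrr.
Qed.

Definition pair_table (N l : rat) : seq (rat * rat) :=
  [:: (0, 1);
      (l / 3 * (Q - s), 3 * (N - 1) / 2);
      (l / 3 * (Q + s), 3 * (N - 1) / 2);
      (l / 2 * (Q - s), (N - 1) * (N - 5) / 8);
      (l / 6 * (3 * Q - s), 3 * (N - 1) ^+ 2 / 8);
      (l / 6 * (3 * Q + s), 3 * (N - 1) ^+ 2 / 8);
      (l / 2 * (Q + s), (N - 1) * (N - 5) / 8)].

Lemma lam_rat_gt0 : 0 < lam%:R :> rat. Proof. by rewrite ltr0n. Qed.

Lemma pair_table_weights (N : rat) :
  unzip1 (pair_table N lam%:R) = map (type_weight Q s lam%:R) pair_types.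
Proof.
by rewrite /pair_table /pair_types /type_weight /=; congr [:: _; _; _; _; _; _; _]; field.
Qed.

(** [#|K|] is the square of an odd number [2 * h + 1], so [M = 2 * (h * h + h)]. Evenness makes the
    halves in [pair_freq] exact. *)
Lemma class_size_rat : (M%:R = (#|F|%:R ^+ j.+1.*2 - 1) / 2 :> rat) /\ ~~ odd M.
Proof.
have MK := card_class_size K chi g0 chiM g0_neq0 chi_g0.
split.
  by rewrite -natrX -cardK MK -natr1 -muln2 natrM addrK mulfK.
rewrite cardK -muln2 expnM in MK.
have : odd (#|F| ^ j.+1) by have := congr1 odd MK; rewrite oddX /= odd_double.
move=> oddX'; have := odd_double_half (#|F| ^ j.+1); rewrite oddX'.
move: (_./2) => h hE; rewrite -hE /= in MK.
have -> : M = (h * h + h).*2 by nia.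
by rewrite odd_double.
Qed.

Lemma pair_table_entries (w f : rat) :
  (w, f) \in pair_table (#|F|%:R ^+ j.+1.*2) lam%:R ->
  exists2 t, t \in pair_types & w = type_weight Q s lam%:R t /\ f = (pair_freq M t)%:R.
Proof.
have [ME Mev] := class_size_rat.
have NE : #|F|%:R ^+ j.+1.*2 = 2 * M%:R + 1 :> rat by rewrite ME; field.
have M_gt0 : (0 < M)%N.
  apply/card_gt0P; exists 1; rewrite inE /qclass oner_eq0.
  by rewrite -(rmorph1 iota) chi_iota ?oner_eq0.
have [h Mh] : exists h, M = (2 * h)%N.
  by exists M./2; rewrite mul2n even_halfK.
have MR : M%:R = 2 * h%:R :> rat by rewrite Mh natrM.
have f1 : (M * (M - 2) %/ 2)%:R = M%:R * (M%:R - 2) / 2 :> rat.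
  have -> : (M * (M - 2) %/ 2 = h * (M - 2))%N by rewrite {1}Mh -mulnA mulKn.
  by rewrite natrM natrB ?MR; [field | lia].
have f2 : (M ^ 2 %/ 2)%:R = M%:R ^+ 2 / 2 :> rat.
  have -> : (M ^ 2 %/ 2 = h * M)%N by rewrite -mulnn {1}Mh -mulnA mulKn.
  by rewrite natrM MR; field.
rewrite NE !inE; do 6?[case/orP]; move=> /eqP[-> ->];
  [ exists (0, 0) | exists (2, -2) | exists (2, 2) | exists (3, -3)
  | exists (3, -1) | exists (3, 1) | exists (3, 3)] => //;
  rewrite /type_weight /pair_freq /= ?natrM ?f1 ?f2 //; split; by field.
Qed.

Lemma weight_distribution_codewords (C : {vspace 'rV[F]_n}) :
  [set v in C] = [set codeword y | y in setT] ->
  weight_distribution C (pair_table (#|F|%:R ^+ j.+1.*2) lam%:R).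
Proof.
move=> CE; have [e wtE] := codeword_weights.
have tw_eq := type_weight_eq _ _ _ s_gt0 lam_rat_gt0 Q_large.
have memC c : c \in C -> exists y, c = codeword y.
  by move=> cC; have : c \in [set v in C] by [rewrite inE]; rewrite CE => /imsetP[y _ ->]; exists y.
split.
- rewrite pair_table_weights map_inj_in_uniq // => t t' tP t'P /eqP.
  by rewrite tw_eq ?pair_types_box // => /eqP.
- move=> _ /memC[y ->]; rewrite pair_table_weights wtE.
  exact/map_f/weight_type_pair.
- move=> w f /pair_table_entries[t tP [-> ->]].
  rewrite -(card_weight_type e _ tP) -(card_imset _ codeword_inj); congr (_%:R).
  apply: eq_card => v; rewrite inE; apply/andP/imsetP => [[/memC[y ->]] | [y + ->]].
    rewrite wtE tw_eq ?pair_types_box ?weight_type_pair // => ty.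
    by exists y => //; rewrite inE.
  rewrite inE => ty; split; last by rewrite wtE (eqP ty).
  have : codeword y \in [set codeword y | y in setT] by rewrite imset_f.
  by rewrite -CE inE.
Qed.

(** * Codes whose three terms always share one quadratic class *)

Definition single_table (N l : rat) : seq (rat * rat) :=
  [:: (0, 1);
      (l / 2 * (Q - s), (N - 1) / 2);
      (l / 2 * (Q + s), (N - 1) / 2)].

Section SingleCode.

Variables (C : {vspace 'rV[F]_n}) (f : K -> K * K).
Hypothesis f_inj : injective f.
Hypothesis CE : [set v in C] = [set codeword (f y) | y in setT].
Hypothesis fE : forall y, class_triple (f y) = (cls y, cls y, cls y).

Let codeword_f_weights : exists e : bool, forall y,
  (wt (codeword (f y)))%:R = type_weight Q s lam%:R (class_type e (cls y) *+ 3).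
Proof.
have [e wtE] := codeword_weights; exists e => y.
by rewrite wtE /weight_type fE !mulrS mulr0n addr0 addrA.
Qed.

Let mem_C c : reflect (exists y, c = codeword (f y)) (c \in C).
Proof.
have -> : (c \in C) = (c \in [set v in C]) by rewrite inE.
by rewrite CE; apply: (iffP imsetP) => [[y _ ->] | [y ->]]; exists y.
Qed.

Lemma weight_distribution_single :
  weight_distribution C (single_table (#|F|%:R ^+ j.+1.*2) lam%:R).
Proof.
have [e wtE] := codeword_f_weights.
have tw_eq := type_weight_eq _ _ _ s_gt0 lam_rat_gt0 Q_large.
have single_types c : class_type e c *+ 3 \in [:: (0, 0); (3, -3); (3, 3)].
  by case: e {wtE} c => [] [[]|].
have single_box : {in [:: (0, 0); (3, -3); (3, 3)], forall t, type_box t} by apply/allP.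
have tableE N : unzip1 (single_table N lam%:R)
     = map (type_weight Q s lam%:R) [:: (0, 0); (3, -3); (3, 3)].
  by rewrite /single_table /type_weight /=; congr [:: _; _; _]; field.
split.
- rewrite tableE map_inj_in_uniq // => t t' tP t'P /eqP.
  by rewrite tw_eq ?single_box // => /eqP.
- by move=> _ /mem_C[y ->]; rewrite tableE wtE map_f.
- move=> w r wr.
  have [c [-> ->]] : exists c, w = type_weight Q s lam%:R (class_type e c *+ 3)
      /\ r = #|[set y | cls y == c]|%:R.
    move: wr; rewrite !inE; have [ME _] := class_size_rat.
    case/or3P => /eqP[-> ->];
      (* The lighter class is the [b] for which [b (+) e] is true, that is [~~ e]. *)
      [exists None | exists (Some (~~ e)) | exists (Some e)];
      rewrite (card_qclass K chi g0 chiM g0_neq0 chi_g0) ?ME; split => //;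
      rewrite /type_weight /=; case: (e) => /=; by field.
  congr (_%:R); rewrite -[RHS](card_imset _ (inj_comp codeword_inj f_inj)).
  have class_inj : injective (fun c => class_type e c *+ 3).
    by case: e {wtE single_types} => [] [[]|] [[]|].
  apply: eq_card => v; rewrite inE; apply/andP/imsetP => [[/mem_C[y ->]] | [y + ->]].
    rewrite wtE tw_eq ?single_box // => /eqP/class_inj yc.
    by exists y; rewrite // inE yc.
  by rewrite inE => /eqP yc; split; [apply/mem_C; exists y | rewrite wtE yc].
Qed.

Lemma two_weight_single : two_weight C.
Proof.
have [e wtE] := codeword_f_weights.
have tw_eq := type_weight_eq _ _ _ s_gt0 lam_rat_gt0 Q_large.
have c1 : chi 1 = false by rewrite -(rmorph1 iota) chi_iota ?oner_eq0.
have q1 : cls 1 = Some false by rewrite /qclass oner_eq0 c1.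
have qg : cls g0 = Some true by rewrite /qclass (negPf g0_neq0) chi_g0.
have boxP c : type_box (class_type e c *+ 3) by case: e {wtE} c => [] [[]|].
have wt_eq y z : (wt (codeword (f y)) == wt (codeword (f z))) = (cls y == cls z).
  rewrite -(eqr_nat rat) !wtE tw_eq //.
  by case: (cls y) (cls z) e {wtE boxP} => [[]|] [[]|] [].
(* Linearity of [C] supplies some [y] whose word is zero; its class must be [None], so [y = 0]. *)
have f0 : codeword (f 0) = 0.
  have : 0 \in C by rewrite mem0v.
  case/mem_C => y y0; have : wt (codeword (f y)) == 0%N.
    by rewrite -y0 /wt cards_eq0; apply/eqP/setP => i; rewrite !inE mxE eqxx.
  rewrite -(eqr_nat rat) wtE.
  have -> : 0%:R = type_weight Q s lam%:R (class_type e None *+ 3).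
    by rewrite /type_weight /= !mul0r addr0 mulr0.
  rewrite tw_eq // => /eqP ty.
  have : cls y = None by move: ty; case: (cls y) e {wtE boxP} => [[]|] [].
  by rewrite /qclass; case: (eqVneq y 0) => // <-; rewrite -y0.
have wt_neq0 y : (wt (codeword (f y)) != 0%N) = (cls y != None).
  rewrite -(qclass0 K chi) -wt_eq f0; congr (_ != _).
  by rewrite /wt; apply/esym/eqP; rewrite cards_eq0; apply/eqP/setP => i; rewrite !inE mxE eqxx.
rewrite /two_weight; set W := undup _.
suff : perm_eq W [:: wt (codeword (f 1)); wt (codeword (f g0))].
  by move/perm_size.
apply: uniq_perm; first exact: undup_uniq.
  by rewrite /= inE wt_eq q1 qg.
move=> x; rewrite mem_undup !inE; apply/imageP/idP.
  case=> c; rewrite inE => /andP[/mem_C[y ->]]; rewrite wt_neq0 => cy ->.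
  by rewrite !wt_eq q1 qg; move: cy; case: (cls y) => [[]|].
by case/orP => /eqP ->; [exists (codeword (f 1)) | exists (codeword (f g0))] => //;
  rewrite inE wt_neq0 ?q1 ?qg andbT; apply/mem_C; [exists 1 | exists g0].
Qed.

End SingleCode.

(** The three terms are [y] times [1], [w] and [- w ^+ 2], all squares. *)
Lemma class_triple_left y : class_triple (y, 0) = (cls y, cls y, cls y).
Proof.
rewrite /class_triple /= mulr0 !addr0.
have -> : y + w * y = (- 1) * (w ^+ 2 * y).
  apply/eqP; rewrite -subr_eq0; apply/eqP.
  by transitivity ((1 + w + w ^+ 2) * y); [ring | rewrite omega_root mul0r].
have cN1 : chi (- 1) = false by rewrite -(rmorphN1 iota) chi_iota // oppr_eq0 oner_eq0.
by rewrite -[w in cls (w * y)]expr1 !qclassM ?oppr_eq0 ?oner_eq0 ?omegaX_neq0 ?chi_omegaX.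
Qed.

Lemma class_triple_right y : class_triple (0, y) = (cls y, cls y, cls y).
Proof.
rewrite /class_triple /= !add0r.
have -> : y + w * (w * y) = (- 1) * (w ^+ 1 * y).
  apply/eqP; rewrite -subr_eq0; apply/eqP.
  by transitivity ((1 + w + w ^+ 2) * y); [ring | rewrite omega_root mul0r].
have cN1 : chi (- 1) = false by rewrite -(rmorphN1 iota) chi_iota // oppr_eq0 oner_eq0.
rewrite mulrA -expr2.
by rewrite !qclassM ?oppr_eq0 ?oner_eq0 ?omegaX_neq0 ?chi_omegaX.
Qed.

Theorem codeword_spaces :
  [/\ injective codeword,
      forall C : {vspace 'rV[F]_n},
        [set v in C] = [set codeword y | y in setT] ->
        weight_distribution C (pair_table (#|F|%:R ^+ j.+1.*2) lam%:R),
      forall C : {vspace 'rV[F]_n},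
        [set v in C] = [set codeword (y, 0) | y in setT] ->
        two_weight C
        /\ weight_distribution C (single_table (#|F|%:R ^+ j.+1.*2) lam%:R)
    & forall C : {vspace 'rV[F]_n},
        [set v in C] = [set codeword (0, y) | y in setT] ->
        two_weight C
        /\ weight_distribution C (single_table (#|F|%:R ^+ j.+1.*2) lam%:R)].
Proof.
have left_inj : injective (fun y : K => (y, 0 : K)) by move=> y z [].
have right_inj : injective (fun y : K => (0 : K, y)) by move=> y z [].
split; first exact: codeword_inj.
- exact: weight_distribution_codewords.
- move=> C CE; split.
    exact: two_weight_single CE class_triple_left.
  exact: weight_distribution_single left_inj CE class_triple_left.
- move=> C CE; split.
    exact: two_weight_single CE class_triple_right.
  exact: weight_distribution_single right_inj CE class_triple_right.
Qed.

End Codewords.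

(** * Cyclic codes and minimal polynomials *)

Lemma card_code (F : finFieldType) (n : nat) (C : {vspace 'rV[F]_n}) :
  #|[set v in C]| = (#|F| ^ \dim C)%N.
Proof. by rewrite cardsE card_vspace. Qed.

Lemma card_finvect (F : finFieldType) (L : fieldExtType F) :
  #|finvect_type L| = (#|F| ^ \dim {:L})%N.
Proof. by rewrite -(card_vspacef (Vector.class (finvect_type L))) card_vspace. Qed.

Section CyclicCodes.

Variables (F : finFieldType) (n : nat).
Hypothesis n_gt0 : (0 < n)%N.
Implicit Types (h : {poly F}) (v : 'rV[F]_n).

Local Notation Xn1 := ('X^n - 1 : {poly F}).

Lemma size_Xn1 : size Xn1 = n.+1.
Proof. exact: size_XnsubC. Qed.

Lemma mk_monic_Xn1 : mk_monic Xn1 = Xn1.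
Proof. by rewrite /mk_monic size_Xn1 ltnS n_gt0 monicXnsubC. Qed.

Lemma val_in_qpoly p : val (in_qpoly Xn1 p) = p %% Xn1.
Proof. by rewrite /= mk_monic_Xn1 Pdiv.IdomainMonic.modpE // monicXnsubC. Qed.

(** Parity-check criterion: cancelling [h] in [Xn1 = (Xn1 %/ h) * h] shows that the word is a
    multiple of the generator. *)
Lemma mem_cyclic_code_dvdp h v : h %| Xn1 -> Xn1 %| rVpoly v * h ->
  v \in cyclic_code n h.
Proof.
move=> /divpK hE; rewrite -{1}hE => dvd.
have h0 : h != 0.
  by apply: contra_eq_neq hE => ->; rewrite mulr0 eq_sym -size_poly_gt0 size_Xn1.
move: dvd; rewrite dvdp_mul2r // => /dvdpP[r vE].
apply/mem_cyclic_code; exists (in_qpoly Xn1 r * in_qpoly Xn1 (Xn1 %/ h)).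
  by apply/imsetP; exists (in_qpoly Xn1 r).
rewrite -in_qpolyM -vE val_in_qpoly modp_small ?rVpolyK //.
by rewrite size_Xn1 ltnS size_poly.
Qed.

(** The multiplier may be reduced modulo [h], because [h] times the generator vanishes in the
    quotient. So [deg h] coefficients parametrize the code, which bounds its dimension. *)
Lemma cyclic_code_multiple h v : h %| Xn1 -> v \in cyclic_code n h ->
  exists b : 'rV[F]_(size h).-1, v = poly_rV (rVpoly b * (Xn1 %/ h)).
Proof.
move=> /divpK hE /mem_cyclic_code[_ /imsetP[r _ ->] ->].
set g := Xn1 %/ h in hE *.
have gh0 : g * h != 0 by rewrite hE -size_poly_gt0 size_Xn1.
have [g0 h0] : g != 0 /\ h != 0 by apply/andP; rewrite -negb_or -mulf_eq0.
have sh : (0 < size h)%N by rewrite size_poly_gt0.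
have sg : (0 < size g)%N by rewrite size_poly_gt0.
have sgh : (size g + size h = n.+2)%N.
  by rewrite -size_Xn1 -hE size_mul // prednK // addn_gt0 sg.
have rh : (size (val r %% h)%R < size h)%N by rewrite ltn_modp.
have -> : val (r * in_qpoly Xn1 g) = (val r %% h) * g.
  have -> : r * in_qpoly Xn1 g = in_qpoly Xn1 (val r * g).
    rewrite in_qpolyM; congr (_ * _); apply: val_inj.
    by rewrite val_in_qpoly modp_small // -[in ltnRHS]mk_monic_Xn1 size_mk_monic.
  rewrite val_in_qpoly {1}(divp_eq (val r) h) mulrDl mulrAC -mulrA hE.
  rewrite modp_addl_mul_small // size_Xn1.
  have [-> | rh0] := eqVneq (val r %% h) 0; first by rewrite mul0r size_poly0.
  by rewrite size_mul // -ltnS prednK ?addn_gt0 ?sg ?orbT // -sgh addnC ltn_add2l.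
exists (poly_rV (val r %% h)); congr (poly_rV (_ * _)).
by rewrite poly_rV_K // -ltnS prednK.
Qed.

Lemma dim_cyclic_code_leq h : h %| Xn1 ->
  (\dim (cyclic_code n h) <= (size h).-1)%N.
Proof.
move=> hX; have qF : (1 < #|F|)%N := finNzRing_gt1 F.
rewrite -(leq_exp2l _ _ qF) -card_code -[(size h).-1]mul1n -card_mx.
pose f (b : 'rV[F]_(size h).-1) := poly_rV (rVpoly b * (Xn1 %/ h)) : 'rV[F]_n.
apply: leq_trans (leq_imset_card f predT); apply/subset_leq_card/subsetP => v.
rewrite inE => /(cyclic_code_multiple _ _ hX)[b ->].
by apply/imsetP; exists b.
Qed.

End CyclicCodes.

(** * Annihilators of the words [phi (g ^+ i * y)] *)

Section OrbitPolynomials.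

Variables (F : finFieldType) (L : fieldExtType F) (n : nat).
Variables (phi : {additive L -> F}) (g : L).
Hypothesis phiZ : forall c x, phi (c *: x) = c * phi x.
Hypothesis n_gt0 : (0 < n)%N.
Hypothesis gX : g ^+ n = 1.

Definition orbit_poly (y : L) : {poly F} := \poly_(i < n) phi (g ^+ i * y).

Lemma orbit_polyD y z : orbit_poly (y + z) = orbit_poly y + orbit_poly z.
Proof.
apply/polyP => i; rewrite coefD !coef_poly.
by case: ifP => _; rewrite ?addr0 // mulrDr raddfD.
Qed.

Lemma orbit_polyZ c y : orbit_poly (c *: y) = c *: orbit_poly y.
Proof.
apply/polyP => i; rewrite coefZ !coef_poly.
by case: ifP => _; rewrite ?mulr0 // -scalerAr phiZ.
Qed.

Lemma orbit_poly0 : orbit_poly 0 = 0.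
Proof. by rewrite -(scale0r 0) orbit_polyZ scale0r. Qed.

(** Multiplication by ['X] is the cyclic shift, which replaces [y] by [g^-1 * y]; the coefficient
    that wraps around yields the multiple of ['X^n - 1]. *)
Lemma orbit_polyX y :
  'X * orbit_poly y = orbit_poly (g^-1 * y) + phi (g^-1 * y) *: ('X^n - 1).
Proof.
have g0 : g != 0.
  by apply: contra_eq_neq gX => ->; rewrite expr0n gtn_eqF // eq_sym oner_eq0.
apply/polyP => i; rewrite coefXM coefD coefZ !coef_poly coefB coefXn coef1.
case: i => [|i] /=.
  by rewrite n_gt0 expr0 mul1r (ltn_eqF n_gt0) sub0r mulrN1 subrr.
rewrite subr0 exprSr -mulrA mulVKf //.
case: (ltngtP i.+1 n) => iN; rewrite ?mulr0 ?addr0 // mulr1 add0r.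
by congr (phi _); rewrite -[RHS]mul1r -gX -iN exprSr -mulrA mulVKf.
Qed.

(** By linearity [f] acts on [y] as [f(g^-1)]. This is why check polynomials are minimal polynomials
    of inverses. *)
Lemma orbit_poly_mulr (f : {poly F}) (y : L) :
  'X^n - 1 %| orbit_poly y * f
              - orbit_poly ((map_poly (in_alg L) f).[g^-1] * y).
Proof.
elim/poly_ind: f y => [|f c IH] y.
  by rewrite rmorph0 horner0 mul0r orbit_poly0 mulr0 subrr dvdp0.
rewrite rmorphD rmorphM /= map_polyX map_polyC /= hornerD hornerM hornerX hornerC.
rewrite mulrDl orbit_polyD mulr_algl orbit_polyZ -mulrA.
set z := g^-1 * y; set fg := _.[_].
have -> : orbit_poly y * (f * 'X + c%:P) - (orbit_poly (fg * z) + c *: orbit_poly y)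
   = (orbit_poly z * f - orbit_poly (fg * z)) + phi z *: f * ('X^n - 1).
  rewrite -!mul_polyC mulrDr mulrA mulrC mulrA orbit_polyX -/z -!mul_polyC; ring.
by rewrite dvdp_add // dvdp_mull.
Qed.

Lemma dvdp_orbit_poly (f : {poly F}) (y : L) :
  root (map_poly (in_alg L) f) g^-1 -> 'X^n - 1 %| orbit_poly y * f.
Proof.
move=> /eqP fg; have := orbit_poly_mulr f y.
by rewrite fg mul0r orbit_poly0 subr0.
Qed.

End OrbitPolynomials.

Section MinimalPolynomials.

Variables (F : finFieldType) (L : fieldExtType F).

Lemma minpoly_base_root (x : L) : root (map_poly (in_alg L) (minpoly_base x)) x.
Proof. by rewrite minpoly_baseE root_minPoly. Qed.

Lemma minpoly_base_dvdp (x : L) (f : {poly F}) :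
  root (map_poly (in_alg L) f) x -> minpoly_base x %| f.
Proof.
move=> fx; rewrite -(dvdp_map (in_alg L)) minpoly_baseE minPoly_dvdp //.
by apply/polyOver1P; exists f.
Qed.

Lemma size_minpoly_base (x : L) :
  size (minpoly_base x) = (adjoin_degree 1%AS x).+1.
Proof. by rewrite -(size_map_poly (in_alg L)) minpoly_baseE size_minPoly. Qed.

Lemma size_minpoly_base_leq (x : L) : (size (minpoly_base x) <= (\dim {:L}).+1)%N.
Proof.
by rewrite size_minpoly_base ltnS adjoin_degreeE dimv1 divn1 dimvS ?subvf.
Qed.

Lemma minpoly_base_monic (x : L) : minpoly_base x \is monic.
Proof. by rewrite -(map_monic (in_alg L)) minpoly_baseE monic_minPoly. Qed.

Lemma minpoly_base_irreducible (x : L) : irreducible_poly (minpoly_base x).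
Proof.
split=> [|f f1 fx].
  by rewrite size_minpoly_base ltnS adjoin_degreeE divn_gt0 ?dimvS ?sub1v ?adim_gt0.
have : map_poly (in_alg L) f %| minPoly 1%AS x.
  by rewrite -minpoly_baseE dvdp_map.
move/minPoly_irr => /(_ (introT polyOver1P (ex_intro _ f erefl))).
rewrite -minpoly_baseE eqp_map => /orP[// | /eqp_size].
by rewrite size_poly1 size_map_poly => f1'; rewrite f1' in f1.
Qed.

Lemma minpoly_base_dvdXn1 (x : L) n : x ^+ n = 1 -> minpoly_base x %| 'X^n - 1.
Proof.
move=> xn; apply: minpoly_base_dvdp.
by rewrite rmorphB rmorph1 /= map_polyXn /root !hornerE xn subrr.
Qed.

End MinimalPolynomials.

(** * Arithmetic of the parameters *)

Lemma odd_geometric_sum (q k : nat) : (0 < k)%N ->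
  odd (\sum_(i < k) q ^ i)%N = (odd q ==> odd k).
Proof.
case: k => // k _; elim: k => [|k IH].
  by rewrite big_ord_recr big_ord0 /= implybT.
by rewrite big_ord_recr oddD IH oddX /=; case: (odd q) => //=; case: (odd k).
Qed.

(** [D] is coprime to [A / 2], so it drops out. Used with [2 * D = Delta] and with [#|F| - 1] for
    [q]. *)
Lemma gcdn_even_part (D q A : nat) : (gcdn (2 * D) A = 2 ->
  gcdn (2 * D * q) A = 2 * gcdn q (A %/ 2))%N.
Proof.
move=> gA; have dA : (2 %| A)%N by rewrite -gA dvdn_gcdr.
have AE : (2 * (A %/ 2) = A)%N by rewrite mulnC divnK.
rewrite -AE in gA *; set B := (_ %/ 2)%N in gA *; rewrite mulKn //.
rewrite -mulnA -!muln_gcdr in gA *; congr (2 * _)%N.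
have {gA}/eqP cop : gcdn D B = 1%N by lia.
by rewrite gcdnC Gauss_gcdr 1?gcdnC // coprime_sym.
Qed.

(* If 3 did not divide the larger order [N / gcd(N, a)], then it would divide
   [N / gcd(N, b)], and the former would be a proper divisor of the latter. *)
Lemma dvd3_max_order (N : nat) (a b : int) : (0 < N)%N -> (3 %| N)%N ->
  a - b = (N %/ 3)%N%:Z \/ a - b = - (N %/ 3)%N%:Z ->
  (N %/ gcdn N `|b| <= N %/ gcdn N `|a|)%N -> (3 %| N %/ gcdn N `|a|)%N.
Proof.
move=> N0 N3 ab le_ba; apply: contraT => n3.
set d := gcdn N `|a| in le_ba n3; set x := gcdn N `|b| in le_ba.
have dN : (d %| N)%N := dvdn_gcdl _ _; have xN : (x %| N)%N := dvdn_gcdl _ _.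
set n := (N %/ d)%N in le_ba n3; set n' := (N %/ x)%N in le_ba.
have nd : (n * d = N)%N by rewrite divnK.
have n'x : (n' * x = N)%N by rewrite divnK.
have d_a : (d %| `|a|)%N := dvdn_gcdr _ _; have x_b : (x %| `|b|)%N := dvdn_gcdr _ _.
have abN : (`|a - b| = N %/ 3)%N by case: ab => ->; rewrite ?abszN.
have n'3 : (3 %| n')%N.
  (* [N] divides both [n * a] and [n' * b]. As [a - b] is [N / 3] up to sign, it follows that 3
     divides [n * n']. *)
  have : (N%:Z %| (n * n')%N%:Z * (a - b))%Z.
    rewrite PoszM mulrBr rpredB //.
      by rewrite mulrAC dvdz_mulr // dvdzE abszM /= -nd dvdn_mul.
    by rewrite -mulrA dvdz_mull // dvdzE abszM /= -n'x dvdn_mul.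
  have M0 : (0 < N %/ 3)%N by rewrite divn_gt0 // dvdn_leq.
  rewrite dvdzE abszM !absz_nat abN -[X in (X %| _)%N](divnK N3).
  by rewrite [(_ %/ 3 * 3)%N]mulnC dvdn_pmul2r // Euclid_dvdM // (negPf n3).
have xN3 : (x %| N %/ 3)%N.
  by rewrite -n'x -(divnK n'3) mulnAC mulnK // dvdn_mull.
have x_a : (x %| `|a|)%N.
  have : (x%:Z %| (a - b) + b)%Z by rewrite rpredD // dvdzE /= ?abN.
  by rewrite subrK.
have /dvdnP[y dE] : (x %| d)%N by rewrite dvdn_gcd xN x_a.
have x0 : (0 < x)%N by rewrite gcdn_gt0 N0.
have n'E : n' = (n * y)%N.
  by apply/eqP; rewrite -(eqn_pmul2r x0) n'x -nd dE mulnA.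
have y3 : (3 %| y)%N by move: n'3; rewrite n'E Euclid_dvdM // (negPf n3).
have : (0 < n')%N by move: N0; rewrite -{1}n'x muln_gt0 => /andP[].
rewrite {1}n'E muln_gt0 => /andP[n0 y0].
move: le_ba (dvdn_leq y0 y3); rewrite n'E -{2}[n]muln1 leq_pmul2l //.
by move=> y1 /leq_trans/(_ y1).
Qed.

(** * Squares and base field elements as powers of [gamma] *)

Section PrimitiveElement.

Variables (F : finFieldType) (L : fieldExtType F) (gamma : L).
Hypothesis gamma_prim : primitive_element gamma.

Local Notation q := #|F|.
Local Notation N := (q ^ \dim {:L} - 1)%N.

Lemma group_order_gt0 : (0 < N)%N.
Proof. by rewrite subn_gt0 -{1}(exp1n (\dim {:L})) ltn_exp2r ?finNzRing_gt1 ?adim_gt0. Qed.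

(** The order of [gamma] divides [N], and its powers must cover [N] nonzero elements. *)
Lemma gamma_prim_root : N.-primitive_root gamma.
Proof.
have [g0 g_gen] := gamma_prim.
set K := finvect_type L; have cardK : #|K| = N.+1.
  by rewrite card_finvect subn1 prednK // expn_gt0 (ltnW (finNzRing_gt1 F)).
have gN : gamma ^+ N = 1.
  apply: (mulfI g0); rewrite -exprS mulr1 -cardK.
  exact: (@expf_card K gamma).
have [m gm mN] := prim_order_exists group_order_gt0 gN.
suff Nm : (N <= m)%N by rewrite (eqP (_ : N == m)) // eqn_leq Nm dvdn_leq // group_order_gt0.
have m0 := prim_order_gt0 gm.
rewrite -[m]card_ord.
pose f (i : 'I_m) : K := gamma ^+ i.
apply: leq_trans (leq_imset_card f predT).
have -> : N = #|[set~ (0 : K)]| by rewrite cardsC1 cardK.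
apply/subset_leq_card/subsetP => x; rewrite !inE => /(g_gen x)[i ->].
apply/imsetP; exists (Ordinal (ltn_pmod i m0)) => //.
by rewrite /f /= (prim_expr_mod gm).
Qed.

Lemma base_field_frobenius (x : L) : x ^+ q = x -> exists c : F, x = c%:A.
Proof.
by move=> xq; apply/vlineP; rewrite (Fermat's_little_theorem 1%AS) dimv1 expn1 xq.
Qed.

Lemma DeltaE : (Delta L * (q - 1) = N)%N.
Proof.
rewrite /Delta divnK // !subn1 predn_exp; exact: dvdn_mulr.
Qed.

(** The [(q - 1)]-th power of [gamma ^+ Delta L] is 1, so Frobenius fixes it. *)
Lemma gamma_Delta : exists2 c : F, c != 0 & gamma ^+ Delta L = c%:A.
Proof.
have [g0 _] := gamma_prim.
have [c cE] : exists c : F, gamma ^+ Delta L = c%:A.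
  apply: base_field_frobenius; rewrite -[q](subnK (ltnW (finNzRing_gt1 F))).
  rewrite exprD -exprM DeltaE expr1 (prim_expr_order gamma_prim_root) mul1r //.
exists c => //; apply: contra_neq (expf_neq0 (Delta L) g0); rewrite cE => ->.
by rewrite scale0r.
Qed.

(* By Euler's criterion; the value at [0] is irrelevant. *)
Definition nonsquare (x : finvect_type L) : bool := x ^+ (N %/ 2) != 1.

Hypothesis Delta_even : (2 %| Delta L)%N.

Lemma group_order_even : (2 %| N)%N.
Proof. by rewrite -DeltaE dvdn_mulr. Qed.

Lemma nonsquare_gamma : nonsquare gamma.
Proof.
rewrite /nonsquare -(prim_order_dvd gamma_prim_root).
have N0 := group_order_gt0; have N2 := group_order_even.
by rewrite gtnNdvd //; [rewrite divn_gt0 // dvdn_leq | rewrite ltn_Pdiv].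
Qed.

Lemma nonsquareM x y : x != 0 -> y != 0 ->
  nonsquare (x * y) = nonsquare x (+) nonsquare y.
Proof.
have pm z : z != 0 -> (z ^+ (N %/ 2) == 1) || (z ^+ (N %/ 2) == - 1 :> L).
  case: gamma_prim => _ g_gen /(g_gen z)[i ->].
  rewrite -sqrf_eq1 -!exprM -mulnA divnK ?group_order_even // mulnC exprM.
  by rewrite (prim_expr_order gamma_prim_root) expr1n.
(* If [-1 = 1], then [gamma ^+ (N %/ 2)] would be 1, making [gamma] a square. *)
have neq : -1 != 1 :> L.
  have := nonsquare_gamma; rewrite /nonsquare.
  case: gamma_prim => g0 _; case/orP: (pm gamma g0) => /eqP->//.
  by rewrite eqxx.
move=> x0 y0; rewrite /nonsquare exprMn.
case/orP: (pm x x0) => /eqP->; case/orP: (pm y y0) => /eqP->;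
  by rewrite ?mulr1 ?mul1r ?mulrNN ?mul1r ?eqxx ?neq.
Qed.

(** Since [Delta] is even, [N / 2] is a multiple of [q - 1]. *)
Lemma nonsquare_base (c : F) : c != 0 -> nonsquare c%:A = false.
Proof.
move=> c0; have cq : c ^+ (q - 1) = 1.
  apply: (mulfI c0); rewrite -exprS mulr1 subn1 prednK ?expf_card //.
  exact: ltnW (finNzRing_gt1 F).
rewrite /nonsquare -DeltaE mulnC -muln_divA // exprM.
have -> : (c%:A : L) ^+ (q - 1) = 1 by rewrite -in_algE -rmorphXn cq rmorph1.
by rewrite expr1n eqxx.
Qed.

Lemma nonsquareX i : ~~ odd i -> nonsquare (gamma ^+ i) = false.
Proof.
move=> iev; apply/negbTE; rewrite negbK -exprM -(prim_order_dvd gamma_prim_root).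
have /divnK <- : (2 %| i)%N by rewrite dvdn2.
by rewrite -mulnA [(2 * _)%N]mulnC divnK ?group_order_even // dvdn_mull.
Qed.

Lemma square_exponent (x : L) : x != 0 -> nonsquare x = false ->
  exists i, x = gamma ^+ (2 * i).
Proof.
case: gamma_prim => _ g_gen /(g_gen x)[i ->] /negbFE.
rewrite -exprM -(prim_order_dvd gamma_prim_root).
rewrite -{1}(divnK group_order_even) mulnC dvdn_pmul2r; last first.
  by have N0 := group_order_gt0; have N2 := group_order_even; rewrite divn_gt0 // dvdn_leq.
by move=> /divnK i2; exists (i %/ 2)%N; rewrite mulnC i2.
Qed.

End PrimitiveElement.

(** [q] is 1 modulo 6 and exceeds 1. The bound yields [6 * s < Q], which separates the weights. *)
Lemma odd_mod3_gt6 (q : nat) :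
  odd q -> (0 < q - 1)%N -> (3 %| q - 1)%N -> (6 < q)%N.
Proof. lia. Qed.

(** * Consequences of the conditions on the two exponents *)

Section CodeExponents.

Variables (F : finFieldType) (L : fieldExtType F) (gamma : L).
Local Notation q := #|F|.
Local Notation k := (\dim {:L}).
Local Notation N := (q ^ k - 1)%N.
Local Notation Delta := (Delta L).

Variables (a b : int) (n lambda : nat).
Hypothesis gamma_prim : primitive_element gamma.
Hypothesis N3 : (3 %| N)%N.
Hypothesis Delta3 : ~~ (3 %| Delta)%N.
Hypothesis ab : a - b = (N %/ 3)%N%:Z \/ a - b = - (N %/ 3)%N%:Z.
Hypothesis nE : n = (N %/ gcdn N `|a|)%N.
Hypothesis n_max : (N %/ gcdn N `|b| <= n)%N.
Hypothesis Delta_a : gcdn Delta `|a| = 2%N.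
Hypothesis lambda_gt0 : (0 < lambda)%N.
Hypothesis lambdaE : (gcdn (q - 1) `|(a %/ 2)%Z|)%:R = (q - 1)%:R / lambda%:R :> rat.

Lemma Delta_even : (2 %| Delta)%N.
Proof. by rewrite -Delta_a dvdn_gcdl. Qed.

Lemma qm1_gt0 : (0 < q - 1)%N.
Proof. by rewrite subn_gt0 finNzRing_gt1. Qed.

Lemma qm1_dvd3 : (3 %| q - 1)%N.
Proof. by move: N3; rewrite -DeltaE Euclid_dvdM // (negPf Delta3). Qed.

(** [Delta] is the sum of the [q ^ i] for [i < k]: odd if [q] is even, of the parity of [k]
    otherwise. *)
Lemma odd_q_even_k : odd q && ~~ odd k.
Proof.
have DE : Delta = (\sum_(i < k) q ^ i)%N.
  apply/eqP; rewrite -(eqn_pmul2r qm1_gt0) DeltaE !subn1 predn_exp mulnC.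
  by [].
have := Delta_even; rewrite dvdn2 DE odd_geometric_sum ?adim_gt0 //.
by case: (odd q) (odd k) => [] [].
Qed.

Lemma q_gt6 : (6 < q)%N.
Proof.
have /andP[q_odd _] := odd_q_even_k.
exact: odd_mod3_gt6 q_odd qm1_gt0 qm1_dvd3.
Qed.

Lemma n_dvd3 : (3 %| n)%N.
Proof. by rewrite nE; apply: dvd3_max_order (group_order_gt0 _ _) N3 ab _; rewrite -nE. Qed.

(** With [G = (q - 1) / lambda], [gcdn_even_part] gives [gcd(N, a) = 2 * G], while
    [N = Delta * lambda * G]. *)
Lemma double_n : (2 * n = lambda * Delta)%N.
Proof.
have a2 : (2 %| `|a|)%N by rewrite -Delta_a dvdn_gcdr.
have hE : `|(a %/ 2)%Z|%N = (`|a| %/ 2)%N.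
  have /dvdzP[c ->] : (2%:Z %| a)%Z by rewrite dvdzE.
  by rewrite mulzK // abszM mulnK.
have := lambdaE; rewrite hE; set G := gcdn (q - 1) _ => GE.
have {}GE : (G * lambda = q - 1)%N.
  apply/eqP; rewrite -(eqr_nat rat) natrM GE divfK // pnatr_eq0 -lt0n //.
have G0 : (0 < G)%N by rewrite gcdn_gt0 qm1_gt0.
have NE : N = (Delta %/ 2 * lambda * (2 * G))%N.
  rewrite -DeltaE -GE -{1}(divnK Delta_even); ring.
have gE : gcdn N `|a| = (2 * G)%N.
  rewrite -DeltaE -{1}(divnK Delta_even) [(_ %/ 2 * 2)%N]mulnC gcdn_even_part //.
  by rewrite mulnC divnK ?Delta_even.
rewrite nE gE {1}NE mulnK ?muln_gt0 ?G0 // mulnA [(2 * _)%N]mulnC divnK ?Delta_even //.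
exact: mulnC.
Qed.

(** Supplies the data for [codeword_spaces], with [g = gamma ^+ A]. Squares are generated by
    [g ^+ 3] and [F^*] because [gcd(3 * A, Delta) = 2] and [gamma ^+ Delta] lies in [F]. *)
Lemma code_parameters : exists (A m j : nat) (w0 : F),
  [/\ gamma ^ a = gamma ^+ A /\ gamma ^ b = w0%:A * gamma ^+ A,
      ~~ odd A, w0 ^+ 3 = 1 /\ w0 != 1,
      [/\ n = (3 * m)%N, k = j.+1.*2, (6 * m = lambda * Delta)%N
        & (gamma ^+ A) ^+ (3 * m) = 1]
    & forall x : finvect_type L, x != 0 -> nonsquare F L x = false ->
        exists i (c : F), c != 0 /\ x = c%:A * (gamma ^+ A) ^+ (3 * i)].
Proof.
have [g0 _] := gamma_prim.
have groot := gamma_prim_root F L gamma gamma_prim.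
have gN := prim_expr_order groot.
have N0 : (0 < N)%N := group_order_gt0 F L.
have [c c0 cE] := gamma_Delta F L gamma gamma_prim.
(* Adding [N] keeps [A] positive, as the Bezout relation below requires. *)
pose A := (`|(a %% N%:Z)%Z| + N)%N.
have AE : gamma ^ a = gamma ^+ A.
  have -> : gamma ^+ A = gamma ^+ `|(a %% N%:Z)%Z| by rewrite /A exprD gN mulr1.
  rewrite {1}(divz_eq a N) expfzDr //.
  rewrite [((_ %/ _)%Z * _)]mulrC -exprz_exp -exprnP gN exp1rz mul1r.
  by rewrite -[in LHS](gez0_abs (modz_ge0 _ _)) // -lt0n.
have gcdNA : gcdn N A = gcdn N `|a|.
  rewrite gcdnDr; have := gcdz_modr N%:Z a.
  by move=> /(congr1 absz).
have gcdDA : gcdn Delta A = 2%N.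
  have DN : gcdn Delta N = Delta by apply/gcdn_idPl; rewrite -(DeltaE F L) dvdn_mulr.
  by rewrite -DN -gcdnA gcdNA gcdnA DN Delta_a.
have [u [u3 u1 uE]] : exists u : F, [/\ u ^+ 3 = 1, u != 1 & gamma ^+ (N %/ 3) = u%:A].
  (* [N / 3 = Delta * ((q - 1) / 3)], so the cube root of unity is a power of
     [gamma ^+ Delta = c%:A]. *)
  exists (c ^+ ((q - 1) %/ 3)).
  have uE : gamma ^+ (N %/ 3) = (c ^+ ((q - 1) %/ 3))%:A.
    by rewrite -(DeltaE F L) -muln_divA ?qm1_dvd3 // exprM cE -!in_algE -rmorphXn.
  split=> //.
    apply: (fmorph_inj (in_alg L)); rewrite rmorphXn rmorph1 /= -uE -exprM.
    by rewrite divnK.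
  apply/eqP => u1; move: uE; rewrite u1 scale1r => /eqP.
  rewrite -(prim_order_dvd groot) gtnNdvd // ?ltn_Pdiv //.
  by rewrite divn_gt0 // dvdn_leq.
have [w0 [w3 w1 bE]] : exists w0 : F,
    [/\ w0 ^+ 3 = 1, w0 != 1 & gamma ^ b = w0%:A * gamma ^+ A].
  have u0 : u != 0 by apply: contra_eq_neq u3 => ->; rewrite expr0n eq_sym oner_eq0.
  have bE : b = - (a - b) + a by ring.
  case: ab => abE.
    exists u^-1; rewrite exprVn u3 invr1 invr_eq1; split=> //.
    rewrite {1}bE expfzDr // AE abE -invr_expz -exprnP uE.
    by congr (_ * _); rewrite -!in_algE fmorphV.
  exists u; split => //.
  by rewrite {1}bE expfzDr // AE abE opprK -exprnP uE.
have /divnK m3 := n_dvd3.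
have /andP[_ k_even] := odd_q_even_k.
have kE : k = (k./2).-1.+1.*2.
  rewrite prednK ?even_halfK //; have := adim_gt0 {:L}%AS.
  by rewrite -{1}(even_halfK k_even) double_gt0.
exists A, (n %/ 3)%N, (k./2).-1, w0; split=> //.
- by rewrite -dvdn2 -gcdDA dvdn_gcdr.
- split=> //; first by rewrite mulnC m3.
    by rewrite -double_n -[in RHS]m3; ring.
  rewrite mulnC m3 -exprM; apply/eqP; rewrite -(prim_order_dvd groot).
  have dN : (n * gcdn N A = N)%N by rewrite gcdNA nE divnK // dvdn_gcdl.
  by rewrite -{1}dN mulnC dvdn_mul // dvdn_gcdr.
- move=> x x0 /(square_exponent F L gamma gamma_prim Delta_even x x0)[i ->].
  have A0 : (0 < 3 * A)%N by rewrite muln_gt0 addn_gt0 N0 orbT.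
  (* Bezout: [km * (3 * A) = kn * Delta + 2], so [gamma ^+ (2 * i)] is a power of [g ^+ 3] divided
     by [c ^+ (kn * i)]. *)
  case: (egcdnP Delta A0) => km kn.
  have -> : gcdn (3 * A) Delta = 2%N.
    by rewrite gcdnC Gauss_gcdr // coprime_sym prime_coprime.
  move=> kE' _; exists (km * i)%N, ((c ^+ (kn * i))^-1); split.
    by rewrite invr_eq0 expf_neq0.
  have cg : (c ^+ (kn * i))%:A = gamma ^+ (Delta * (kn * i)).
    by rewrite [RHS]exprM cE -!in_algE rmorphXn.
  have cA : ((c ^+ (kn * i))^-1)%:A = ((c ^+ (kn * i))%:A : L)^-1.
    by rewrite -!in_algE fmorphV.
  rewrite cA cg; apply: (mulfI (expf_neq0 (Delta * (kn * i)) g0)).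
  rewrite mulVKf ?expf_neq0 // -exprM -exprD; congr (_ ^+ _).
  transitivity ((kn * Delta + 2) * i)%N; first by ring.
  by rewrite -kE'; ring.
Qed.

End CodeExponents.

(** * The codes *)

(** A coordinate function takes the place usually held by the trace. *)
Lemma functional_exists (F : finFieldType) (L : fieldExtType F) :
  exists phi : {additive L -> F},
    (forall c x, phi (c *: x) = c * phi x) /\ exists x, phi x != 0.
Proof.
have i0 : 'I_(\dim {:L}) := Ordinal (adim_gt0 {:L}%AS).
exists (coord (vbasis {:L}) i0); split; first by move=> c x; rewrite /= linearZ.
exists (vbasis {:L})`_i0.
by rewrite /= coord_free ?eqxx ?oner_neq0 // (basis_free (vbasisP _)).
Qed.

(** Sandwich: injectivity gives [q ^ k] words in the code, whose dimension is at most [deg h],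
    itself at most [k]. All bounds are therefore equalities. *)
Lemma orbit_code (F : finFieldType) (L : fieldExtType F) (n : nat)
    (phi : {additive L -> F}) (g : L) :
    (forall c x, phi (c *: x) = c * phi x) -> (0 < n)%N -> g ^+ n = 1 ->
    injective (fun y : finvect_type L => poly_rV (orbit_poly F L n phi g y) : 'rV[F]_n) ->
  [/\ minpoly_base g^-1 %| 'X^n - 1,
      size (minpoly_base g^-1) = (\dim {:L}).+1,
      \dim (cyclic_code n (minpoly_base g^-1)) = \dim {:L}
    & [set v in cyclic_code n (minpoly_base g^-1)]
      = [set poly_rV (orbit_poly F L n phi g y) | y : finvect_type L in setT]].
Proof.
move=> phiZ n_gt0 gX f_inj; set h := minpoly_base _; set C := cyclic_code _ _.
have q1 : (1 < #|F|)%N := finNzRing_gt1 F.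
have hX : h %| 'X^n - 1 by apply: minpoly_base_dvdXn1; rewrite exprVn gX invr1.
set S := [set _ | _ in _].
have S_C : S \subset [set v in C].
  apply/subsetP => _ /imsetP[y _ ->]; rewrite inE; apply: mem_cyclic_code_dvdp => //.
  rewrite poly_rV_K ?size_poly //.
  exact: dvdp_orbit_poly phiZ n_gt0 gX _ _ (minpoly_base_root _ _ _).
have cardS : #|S| = (#|F| ^ \dim {:L})%N by rewrite card_imset // cardsT card_finvect.
have dimC := dim_cyclic_code_leq F n n_gt0 h hX; rewrite -/C in dimC.
have szh := size_minpoly_base_leq F L g^-1; rewrite -/h in szh.
have := subset_leq_card S_C; rewrite cardS card_code leq_exp2l // => le_dim.
have h0 : (0 < size h)%N by rewrite size_minpoly_base.
have dimE : \dim C = \dim {:L} by lia.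
split=> //; first by lia.
by apply/esym/eqP; rewrite eqEcard S_C cardS card_code dimE leqnn.
Qed.

Section CodePair.

Variables (F : finFieldType) (L : fieldExtType F) (gamma : L).
Local Notation q := #|F|.
Local Notation k := (\dim {:L}).
Local Notation N := (q ^ k - 1)%N.

Variables (a b : int) (n lambda : nat) (p : nat).
Hypothesis gamma_prim : primitive_element gamma.
Hypothesis N3 : (3 %| N)%N.
Hypothesis Delta3 : ~~ (3 %| Delta L)%N.
Hypothesis ab : a - b = (N %/ 3)%N%:Z \/ a - b = - (N %/ 3)%N%:Z.
Hypothesis nE : n = (N %/ gcdn N `|a|)%N.
Hypothesis n_max : (N %/ gcdn N `|b| <= n)%N.
Hypothesis Delta_a : gcdn (Delta L) `|a| = 2%N.
Hypothesis lambda_gt0 : (0 < lambda)%N.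
Hypothesis lambdaE : (gcdn (q - 1) `|(a %/ 2)%Z|)%:R = (q - 1)%:R / lambda%:R :> rat.

Let Ca := cyclic_code n (h_ gamma a).
Let Cb := cyclic_code n (h_ gamma b).
Let Cab := cyclic_code n (h_ gamma a * h_ gamma b).

Let Q : rat := q%:R ^+ (k - 1).
Let s : rat := q%:R ^+ ((k - 2) %/ 2).
Let l : rat := lambda%:R.
Let Nr : rat := q%:R ^+ k.

Let single_code (c : int) (C : {vspace 'rV[F]_n}) :=
  [/\ semiprimitive p gamma c C, two_weight C, \dim C = k
    & weight_distribution C
        [:: (0, 1);
            (l / 2 * (Q - s), (Nr - 1) / 2);
            (l / 2 * (Q + s), (Nr - 1) / 2)]].

(** [Delta] divides [N / 3], so [a] and [b] are congruent modulo [Delta]. *)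
Lemma Delta_b : gcdn (Delta L) `|b| = 2%N.
Proof.
have DM : (Delta L %| N %/ 3)%N.
  by rewrite -(DeltaE F L) -muln_divA ?(qm1_dvd3 F L) // dvdn_mulr.
have [x bE] : exists x : int, b = a + x * (Delta L)%:Z.
  move/dvdnP: DM => [y yE]; have := ab; rewrite yE => -[] abE.
    by exists (- y%:Z); rewrite mulNr -PoszM -abE; ring.
  by exists y%:Z; rewrite -PoszM -[(y * _)%N%:Z]opprK -abE; ring.
have := gcdzMDl x (Delta L)%:Z a; rewrite addrC -bE => /(congr1 absz).
by rewrite /gcdz /= Delta_a.
Qed.

Theorem code_pair :
  [/\ Ca != Cb, single_code a Ca, single_code b Cb
    & [/\ has_parity_check (h_ gamma a * h_ gamma b) Cab,
      \dim Cab = (2 * k)%N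
    & weight_distribution Cab
        [:: (0, 1);
            (l / 3 * (Q - s), 3 * (Nr - 1) / 2);
            (l / 3 * (Q + s), 3 * (Nr - 1) / 2);
            (l / 2 * (Q - s), (Nr - 1) * (Nr - 5) / 8);
            (l / 6 * (3 * Q - s), 3 * (Nr - 1) ^+ 2 / 8);
            (l / 6 * (3 * Q + s), 3 * (Nr - 1) ^+ 2 / 8);
            (l / 2 * (Q + s), (Nr - 1) * (Nr - 5) / 8)]]].
Proof.
pose K := finvect_type L.
have q1 : (1 < q)%N := finNzRing_gt1 F.
have De : (2 %| Delta L)%N by rewrite -Delta_a dvdn_gcdl.
have [A [m [j [w0 [[aE bE] Aev [w3 w1] [n3 kE m6 gX] sqgen]]]]] :=
  code_parameters F L gamma a b n lambda gamma_prim N3 Delta3 ab nE n_max Delta_a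
    lambda_gt0 lambdaE.
have n_gt0 : (0 < n)%N.
  have : (0 < 6 * m)%N.
    rewrite m6 muln_gt0 lambda_gt0 /=; have := group_order_gt0 F L.
    by rewrite -DeltaE muln_gt0 => /andP[].
  by rewrite n3 !muln_gt0.
have [phi [phiZ phi0]] := functional_exists F L.
have [gamma0 _] := gamma_prim.
(* These are [gamma ^ a] and [gamma ^ b]; their orbit words are the codewords of [(y, 0)] and
   [(0, y)]. *)
pose g : K := gamma ^+ A; pose g' : K := w0%:A * g.
have phiZ' (c : F) (x : L) : phi (in_alg L c * x) = c * phi x.
  by rewrite mulr_algl phiZ.
have cardK : #|K| = (q ^ j.+1.*2)%N by rewrite card_finvect kE.
have deltaE : (Delta L * q.-1 = #|K|.-1)%N by rewrite -!subn1 DeltaE card_finvect.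
have q_large : (6 < q)%N by apply: q_gt6 N3 Delta3 Delta_a.
have [inj wdP wdL wdR] := codeword_spaces F K (in_alg L) phi (nonsquare F L) gamma
  phiZ' phi0 (nonsquareM F L gamma gamma_prim De) gamma0
  (nonsquare_gamma F L gamma gamma_prim De) (nonsquare_base F L De)
  g w0 m j lambda (Delta L) n (expf_neq0 A gamma0)
  (nonsquareX F L gamma gamma_prim De A Aev) gX w3 w1 sqgen cardK
  q_large lambda_gt0 m6 deltaE n3.
pose cw := codeword F K (in_alg L) phi g w0 n.
have leftE (y : K) : cw (y, 0) = poly_rV (orbit_poly F L n phi g y).
  by apply/rowP => i; rewrite !mxE coef_poly ltn_ord /= mulr0 addr0.
have rightE (y : K) : cw (0, y) = poly_rV (orbit_poly F L n phi g' y).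
  apply/rowP => i; rewrite !mxE coef_poly ltn_ord /= add0r mulrA -exprMn.
  by rewrite [g * _]mulrC.
have gn : (g : L) ^+ n = 1 by rewrite n3.
have g'n : (g' : L) ^+ n = 1.
  rewrite exprMn gn mulr1 -in_algE -rmorphXn n3 exprM w3 expr1n.
  exact: rmorph1.
have haE : h_ gamma a = minpoly_base (g : L)^-1 by rewrite /h_ -invr_expz aE.
have hbE : h_ gamma b = minpoly_base (g' : L)^-1 by rewrite /h_ -invr_expz bE.
have left_inj : injective (fun y : K => poly_rV (orbit_poly F L n phi g y) : 'rV[F]_n).
  by move=> y z; rewrite -!leftE => /inj[].
have right_inj : injective (fun y : K => poly_rV (orbit_poly F L n phi g' y) : 'rV[F]_n).
  by move=> y z; rewrite -!rightE => /inj[].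
have [haX sza dima CaE] := orbit_code F L n phi g phiZ n_gt0 gn left_inj.
have [hbX szb dimb CbE] := orbit_code F L n phi g' phiZ n_gt0 g'n right_inj.
rewrite -haE in haX sza dima CaE; rewrite -hbE in hbX szb dimb CbE.
have {}CaE : [set v in Ca] = [set cw (y, 0) | y in setT].
  by rewrite CaE; apply: eq_imset => y; rewrite leftE.
have {}CbE : [set v in Cb] = [set cw (0, y) | y in setT].
  by rewrite CbE; apply: eq_imset => y; rewrite rightE.
have Q_exp : (k - 1 = j.*2.+1)%N by rewrite kE doubleS subn1.
have s_exp : ((k - 2) %/ 2 = j)%N by rewrite kE doubleS subn2 /= -muln2 mulnK.
have single (c : int) (C : {vspace 'rV[F]_n}) : C = cyclic_code n (h_ gamma c) ->
    h_ gamma c %| 'X^n - 1 -> size (h_ gamma c) = k.+1 -> \dim C = k ->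
    gcdn (Delta L) `|c| = 2%N ->
    two_weight C /\ weight_distribution C (single_table F j (q%:R ^+ j.+1.*2) l) ->
  single_code c C.
  move=> CE hX szh dimC Dc [tw wd]; split=> //.
    (* Here [u = 2], and [-1] is congruent to [p ^ 0 = 1] modulo 2. *)
    rewrite /semiprimitive Dc; split=> //; last by exists 0%N.
    by split=> //; exact: minpoly_base_irreducible.
  by rewrite /Q /s /Nr Q_exp s_exp kE.
have Ca_neq_Cb : Ca != Cb.
  apply/eqP => CC; have : cw (1, 0) \in [set v in Cb] by rewrite -CC CaE; apply/imsetP; exists 1.
  by rewrite CbE => /imsetP[y _ /inj[/eqP]]; rewrite oner_eq0.
have cop : coprimep (h_ gamma a) (h_ gamma b).
  (* Otherwise the two monic irreducible polynomials would coincide, and so would the codes. *)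
  rewrite (irreducible_poly_coprime _ (minpoly_base_irreducible F L _)).
  apply: contra Ca_neq_Cb => dvd_ab; rewrite /Ca /Cb; suff -> : h_ gamma a = h_ gamma b by [].
  apply/eqP; rewrite -eqp_monic ?minpoly_base_monic //.
  apply: (minpoly_base_irreducible F L _).2 => //.
  by rewrite sza eqSS -lt0n adim_gt0.
have habX : h_ gamma a * h_ gamma b %| 'X^n - 1 by rewrite Gauss_dvdp // haX.
have cwD (y : K * K) : cw y = cw (y.1, 0) + cw (0, y.2).
  by apply/rowP => i; rewrite !mxE -raddfD /= mulr0 addr0 add0r -mulrDr.
have sub : [set cw y | y in setT] \subset [set v in Cab].
  apply/subsetP => _ /imsetP[y _ ->]; rewrite inE; apply: mem_cyclic_code_dvdp => //.
  rewrite cwD leftE rightE raddfD /= !poly_rV_K ?size_poly // mulrDl dvdp_add //.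
    rewrite mulrA dvdp_mulr // haE.
    exact: dvdp_orbit_poly phiZ n_gt0 gn _ _ (minpoly_base_root _ _ _).
  rewrite mulrCA dvdp_mull // hbE.
  exact: dvdp_orbit_poly phiZ n_gt0 g'n _ _ (minpoly_base_root _ _ _).
have card_cw : #|[set cw y | y in setT]| = (q ^ (2 * k))%N.
  by rewrite card_imset // cardsT card_prod card_finvect -expnD addnn mul2n.
have size_ab : (size (h_ gamma a * h_ gamma b)%R).-1 = (2 * k)%N.
  by rewrite size_mul -?size_poly_gt0 ?sza ?szb // addSn addnS /= addnn mul2n.
have dim_ab : \dim Cab = (2 * k)%N.
  apply/eqP; rewrite eqn_leq -{1}size_ab dim_cyclic_code_leq //=.
  by rewrite -(leq_exp2l _ _ q1) -card_cw -card_code subset_leq_card.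
have CabE : [set v in Cab] = [set cw y | y in setT].
  by apply/esym/eqP; rewrite eqEcard sub card_cw card_code dim_ab leqnn.
split=> //.
- exact: single (wdL _ CaE).
- exact: single Delta_b (wdR _ CbE).
- by split=> //; rewrite /Q /s /Nr Q_exp s_exp kE; exact: wdP.
Qed.

End CodePair.

Theorem theorem1 (p t k q : nat) (F : finFieldType) (L : fieldExtType F)
  (gamma : L) (a1 a2 a : int) (n lambda : nat)
  (C1 C2 C12 : {vspace 'rV[F]_n})
  (p_prime : prime p) (t_gt0 : (0 < t)%N) (k_gt0 : (0 < k)%N)
  (hq : q = (p ^ t)%N) (cardF : #|F| = q) (dimL : \dim {:L} = k)
  (gamma_prim : primitive_element gamma)
  (h3 : (3 %| q ^ k - 1)%N) (h3Delta : ~~ (3 %| Delta L)%N)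
  (ha12 : a1 - a2 = ((q ^ k - 1) %/ 3)%N%:Z
       \/ a1 - a2 = - ((q ^ k - 1) %/ 3)%N%:Z)
  (hn : n = maxn ((q ^ k - 1) %/ gcdn (q ^ k - 1) `|a1|)
                 ((q ^ k - 1) %/ gcdn (q ^ k - 1) `|a2|))
  (ha : a = if n == ((q ^ k - 1) %/ gcdn (q ^ k - 1) `|a1|)%N
            then a1 else a2)
  (hgcd : gcdn (Delta L) `|a| = 2%N)
  (lambda_gt0 : (0 < lambda)%N)
  (hlambda : (gcdn (q - 1) `|(a %/ 2)%Z|)%:R
             = (q - 1)%:R / lambda%:R :> rat)
  (hC1 : C1 = cyclic_code n (h_ gamma a1))
  (hC2 : C2 = cyclic_code n (h_ gamma a2))
  (hC12 : C12 = cyclic_code n (h_ gamma a1 * h_ gamma a2)) :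
  let N : rat := q%:R ^+ k in
  let Q : rat := q%:R ^+ (k - 1) in
  let s : rat := q%:R ^+ ((k - 2) %/ 2) in
  let l : rat := lambda%:R in
  [/\ C1 != C2,
      semiprimitive p gamma a1 C1,
      semiprimitive p gamma a2 C2
    & forall C, C \in [:: C1; C2] ->
      [/\ two_weight C,
          \dim C = k
        & weight_distribution C
            [:: (0, 1);
                (l / 2 * (Q - s), (N - 1) / 2);
                (l / 2 * (Q + s), (N - 1) / 2)]]]
  /\
  [/\ has_parity_check (h_ gamma a1 * h_ gamma a2) C12,
      \dim C12 = (2 * k)%N
    & weight_distribution C12
        [:: (0, 1);
            (l / 3 * (Q - s), 3 * (N - 1) / 2);
            (l / 3 * (Q + s), 3 * (N - 1) / 2);
            (l / 2 * (Q - s), (N - 1) * (N - 5) / 8);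
            (l / 6 * (3 * Q - s), 3 * (N - 1) ^+ 2 / 8);
            (l / 6 * (3 * Q + s), 3 * (N - 1) ^+ 2 / 8);
            (l / 2 * (Q + s), (N - 1) * (N - 5) / 8)]].
Proof.
clear hq; subst q k C1 C2 C12 => N Q s l.
set e1 := ((_ - 1) %/ gcdn _ `|a1|)%N in hn ha.
set e2 := ((_ - 1) %/ gcdn _ `|a2|)%N in hn.
case: (eqVneq n e1) ha => [n_e1 | n_e1] ha; rewrite {}ha in hgcd hlambda.
  have le_n : (e2 <= n)%N by rewrite hn leq_maxr.
  have [C12_neq [sp1 tw1 dim1 wd1] [sp2 tw2 dim2 wd2] C12P] :=
    code_pair F L gamma a1 a2 n lambda p gamma_prim h3 h3Delta ha12 n_e1 le_n hgcd
      lambda_gt0 hlambda.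
  by split=> //; split=> // C; rewrite !inE => /orP[] /eqP->.
have n_e2 : n = e2.
  by move: n_e1; rewrite hn; case: (leqP e1 e2) => //; rewrite eqxx.
have le_n : (e1 <= n)%N by rewrite hn leq_maxl.
(* The maximum is attained only at [a2]. The free sign in the condition on [a1 - a2] allows the two
   exponents to be exchanged. *)
have ha21 : a2 - a1 = ((#|F| ^ \dim {:L} - 1) %/ 3)%N%:Z
         \/ a2 - a1 = - ((#|F| ^ \dim {:L} - 1) %/ 3)%N%:Z.
  by rewrite -opprB; case: ha12 => ->; [right | left; rewrite opprK].
have [C21_neq [sp2 tw2 dim2 wd2] [sp1 tw1 dim1 wd1] C12P] :=
  code_pair F L gamma a2 a1 n lambda p gamma_prim h3 h3Delta ha21 n_e2 le_n hgcd
    lambda_gt0 hlambda.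
rewrite [h_ gamma a1 * _]mulrC; split=> //; split=> //; first by rewrite eq_sym.
by move=> C; rewrite !inE => /orP[] /eqP->.
Qed.
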